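(* Let $n\ge 1$, let $\lambda$ be an $n$-partition and let $w\in S_n$. A semistandard tableau $T$ of shape $\lambda$ (with entries in $\{1,\dots,n\}$) is a Demazure tableau for $w$ (i.e. $R(T)\le Y_\lambda(w)$) if and only if $T(l,k)\in B(T,w;l,k)$ for all $(l,k)\in\lambda$.
   Context: Basic notation. An $n$-partition is $\lambda=(\lambda_1\ge\cdots\ge\lambda_n\ge 0)$ with integer parts. Its Young diagram has $\lambda_i$ left-justified boxes in row $i$ (rows numbered from the top); the box in column $j$ and row $i$ is denoted $(j,i)\in\lambda$. $\zeta=(\zeta_1,\dots,\zeta_{\lambda_1})$ is the sequence of column lengths. A semistandard tableau $T$ of shape $\lambda$ is a filling with entries in $[n]=\{1,\dots,n\}$, weakly increasing along rows and strictly increasing down columns; $\mathcal{T}_\lambda$ is the set of these, and $T(j,i)$ is the entry at $(j,i)$. $T\le T'$ means $T(j,i)\le T'(j,i)$ for all $(j,i)\in\lambda$. Intervals $[p,q]$ are intervals of integers. Key of $w$. The one rowed form of $w\in S_n$ is $(x_1,\dots,x_n)$ with $x_i=w(i)$. $Y_\lambda(w)$ is the tableau of shape $\lambda$ each of whose columns of length $k$ consists of $x_1,\dots,x_k$ arranged in increasing order downward. Write $Y(w;j,i)$ for its entry at $(j,i)$. Right key and Demazure tableaux. A skew tableau is a filling of a skew diagram $\lambda'\setminus\beta$ with entries in $[n]$, weakly increasing along rows and strictly increasing down columns. Its rectification is the (well-defined) semistandard tableau obtained by successive jeu de taquin slides into inside corners until none are left. A skew tableau is frank if its column lengths are a rearrangement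 of those of its rectification. For $T\in\mathcal{T}_\lambda$, the right key $R(T)$ is the tableau of shape $\lambda$ whose $j$th column ($1\le j\le\lambda_1$) is the rightmost column of any frank skew tableau that rectifies to $T$ and whose rightmost column has length $\zeta_j$ (this is well defined). $T$ is a Demazure tableau (of shape $\lambda$) for $w$ if $R(T)\le Y_\lambda(w)$. Scanning paths. Fix $T\in\mathcal{T}_\lambda$ and a column $j$. Set $T^{(1)}:=T$, with column lengths $\zeta^{(1)}:=\zeta$. Given $T^{(i)}$ with column lengths $\zeta^{(i)}$ ($1\le i\le\zeta_j$), form a path of boxes starting with the bottom box $(j,\zeta^{(i)}_j)$ of column $j$; repeatedly, from the most recently appended box (in column $h'$), find the smallest $h>h'$ such that the bottom entry $T^{(i)}(h,\zeta^{(i)}_h)$ of column $h$ (ignoring empty columns) is at least the entry in the most recently appended box, and append $(h,\zeta^{(i)}_h)$; stop when there is no such $h$. This path is denoted $P(T;j,\zeta_j-(i-1))$. Remove its boxes to obtain $T^{(i+1)}$, and continue. This yields paths $P(T;j,i)$ for $1\le i\le\zeta_j$, where $P(T;j,i)$ starts at $(j,i)$. This is done independently for each column $j$, starting from $T$. For each $(l,k)\in\lambda$ and $j\le l$ there is exactly one $i\in[1,\zeta_j]$ with $(l,k)\in P(T;j,i)$. Local condition set. Fix $(l,k)\in\lambda$. For $1\le j\le l-1$: let $a(j)$ be the row index with $(l-1,k)\in P(T;j,a(j))$; let $b(j)$ be the row index with $(l,k+1)\in P(T;j,b(j))$ if $k<\zeta_l$, and $b(j):=\zeta_j+1$ if $k=\zeta_l$.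 For $a(j)\le i\le b(j)-1$, let $h$ be the largest value less than $l$ such that $(h,m)\in P(T;j,i)$ for some $m$, and put $E(l,k;j,i):=T(h,m)$. For $j=l$ set $a(l):=b(l)-1:=k$ and $E(l,k;l,k):=k$. Then $$B(T,w;l,k):=\bigcap_{j=1}^{l}\ \Bigl(\bigcup_{i=a(j)}^{b(j)-1}[\,E(l,k;j,i),\,Y(w;j,i)\,]\Bigr).$$ *)

(* Defs.v *)
(* MathComp world. *)
From mathcomp Require Import all_boot all_fingroup.

Set Implicit Arguments.
Unset Strict Implicit.
Unset Printing Implicit Defensive.

(* Conventions.  A box is a pair (column, row), and columns, rows and entries
   are all numbered from 1.  A partition is a weakly decreasing sequence of
   naturals, trailing zeros being allowed.  A filling is a total function on
   boxes, whose values off the diagram under consideration are irrelevant. *)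

Definition box : Type := (nat * nat)%type.
Definition filling : Type := box -> nat.

Definition is_partition (mu : seq nat) : bool := sorted geq mu.

Definition part (mu : seq nat) (i : nat) : nat := nth 0 mu i.-1.

Definition diagram (mu : seq nat) : pred box :=
  [pred b | [&& 0 < b.1, 0 < b.2 & b.1 <= part mu b.2]].

(* Column length, meaningful for j >= 1. *)
Definition zeta (mu : seq nat) (j : nat) : nat := count (leq j) mu.

Definition right_of (b : box) : box := (b.1.+1, b.2).
Definition below (b : box) : box := (b.1, b.2.+1).

(* Comparing horizontally and vertically adjacent boxes suffices, because the
   rows and columns of a skew diagram are intervals. *)
Definition semistandard (n : nat) (D : pred box) (T : filling) : Prop :=
  [/\ forall b, b \in D -> 1 <= T b <= n,
      forall b, b \in D -> right_of b \in D -> T b <= T (right_of b)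
    & forall b, b \in D -> below b \in D -> T b < T (below b)].

Definition filling_le (mu : seq nat) (T T' : filling) : Prop :=
  forall b, b \in diagram mu -> T b <= T' b.

(** Keys of permutations *)

Definition one_rowed_form (n : nat) (w : 'S_n) : seq nat :=
  [seq (w i : nat).+1 | i <- enum 'I_n].

Definition key_tableau (n : nat) (mu : seq nat) (w : 'S_n) : filling :=
  fun b => nth 0 (sort leq (take (zeta mu b.1) (one_rowed_form w))) b.2.-1.

(** Skew tableaux and jeu de taquin *)

Record skew := Skew { outer : seq nat; inner : seq nat; entry : filling }.

Definition skew_diagram (S : skew) : pred box :=
  [pred b | (b \in diagram (outer S)) && (b \notin diagram (inner S))].

Definition skew_tableau (n : nat) (S : skew) : Prop :=
  [/\ is_partition (outer S), is_partition (inner S),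
      forall b, b \in diagram (inner S) -> b \in diagram (outer S)
    & semistandard n (skew_diagram S) (entry S)].

(* An unskewed filling of shape mu. *)
Definition straight (mu : seq nat) (T : filling) : skew := Skew mu [::] T.

(* The entries of the j-th column, read downward. *)
Definition column (S : skew) (j : nat) : seq nat :=
  [seq entry S (j, i)
     | i <- iota (zeta (inner S) j).+1 (zeta (outer S) j - zeta (inner S) j)].

(* Columns of the skew diagram containing no box are ignored. *)
Definition columns (S : skew) : seq (seq nat) :=
  [seq c <- [seq column S j | j <- iota 1 (part (outer S) 1)] | 0 < size c].

Definition column_lengths (S : skew) : seq nat := map size (columns S).

Definition rightmost_column (S : skew) : seq nat := last [::] (columns S).

Definition corner (mu : seq nat) (b : box) : bool :=
  [&& b \in diagram mu, right_of b \notin diagram mu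
    & below b \notin diagram mu].

(* Deletes the corner b of mu, which is the last box of its row. *)
Definition remove_corner (mu : seq nat) (b : box) : seq nat :=
  set_nth 0 mu b.2.-1 b.1.-1.

(* move_hole mu T b T' b': within the partition mu, the hole that starts at b
   ends at b', turning the filling T into T'.  Of the entries to the right of
   and below the hole the smaller one moves into it, the lower one if they are
   equal. *)
Inductive move_hole (mu : seq nat) : filling -> box -> filling -> box -> Prop :=
| MoveStop T b :
    right_of b \notin diagram mu -> below b \notin diagram mu ->
    move_hole mu T b T b
| MoveRight T b T' b' :
    right_of b \in diagram mu ->
    (below b \in diagram mu -> T (right_of b) < T (below b)) ->
    move_hole mu [eta T with b |-> T (right_of b)] (right_of b) T' b' ->
    move_hole mu T b T' b'
| MoveDown T b T' b' :
    below b \in diagram mu ->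
    (right_of b \in diagram mu -> T (below b) <= T (right_of b)) ->
    move_hole mu [eta T with b |-> T (below b)] (below b) T' b' ->
    move_hole mu T b T' b'.

Definition slide (S S' : skew) : Prop :=
  exists c b : box,
    [/\ corner (inner S) c,
        move_hole (outer S) (entry S) c (entry S') b,
        inner S' = remove_corner (inner S) c
      & outer S' = remove_corner (outer S) b].

(* Slides are performed until no inside corner is left. *)
Inductive rectification : skew -> skew -> Prop :=
| RectDone S : (forall c, ~~ corner (inner S) c) -> rectification S S
| RectSlide S S' S'' :
    slide S S' -> rectification S' S'' -> rectification S S''.

(* Since fillings carry irrelevant values, straight tableaux are compared
   through their columns, which determine both shape and entries. *)
Definition rectifies_to (S : skew) (mu : seq nat) (T : filling) : Prop :=
  exists2 S', rectification S S' & columns S' = columns (straight mu T).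

Definition frank (S : skew) : Prop :=
  exists2 S', rectification S S' &
    perm_eq (column_lengths S) (column_lengths S').

(** Right keys and Demazure tableaux *)

Definition right_key_witness (n : nat) (lam : seq nat) (T : filling) (j : nat)
    (S : skew) : Prop :=
  [/\ skew_tableau n S, frank S, rectifies_to S lam T
    & size (rightmost_column S) = zeta lam j].

(* R is the right key of T.  This relation has the well-definedness of the
   right key built in: for each column a suitable frank skew tableau exists,
   and all of them have the same rightmost column. *)
Definition is_right_key (n : nat) (lam : seq nat) (T R : filling) : Prop :=
  forall j, 1 <= j <= part lam 1 ->
    (exists S, right_key_witness n lam T j S) /\
    (forall S, right_key_witness n lam T j S ->
       rightmost_column S = column (straight lam R) j).

Definition demazure (n : nat) (lam : seq nat) (w : 'S_n) (T : filling) : Prop :=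
  exists2 R, is_right_key n lam T R & filling_le lam R (key_tableau lam w).

(** Scanning paths *)

Section Scanning.

Variables (lam : seq nat) (T : filling).

(* The successive tableaux in the scanning process are restrictions of T, and
   are recorded by their column lengths z alone.  Reading the columns hs from
   left to right, a bottom entry is appended as soon as it is at least the
   value v of the most recently appended entry. *)
Fixpoint scan (z : nat -> nat) (v : nat) (hs : seq nat) : seq box :=
  if hs is h :: hs' then
    if (0 < z h) && (v <= T (h, z h))
    then (h, z h) :: scan z (T (h, z h)) hs'
    else scan z v hs'
  else [::].

Definition bottom_path (j : nat) (z : nat -> nat) : seq box :=
  (j, z j) :: scan z (T (j, z j)) (iota j.+1 (part lam 1 - j)).

(* A path meets each column at most once, in its bottom box. *)
Definition remove_path (j : nat) (z : nat -> nat) : nat -> nat :=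
  fun h => z h - (h \in map fst (bottom_path j z)).

(* P(T; j, i): the path starting at (j, i), found after the paths starting at
   the zeta_j - i lower boxes of column j have been removed. *)
Definition path_at (j i : nat) : seq box :=
  bottom_path j (iter (zeta lam j - i) (remove_path j) (zeta lam)).

(* The i with b on P(T; j, i). *)
Definition path_row (j : nat) (b : box) : nat :=
  (find (fun i => b \in path_at j i) (iota 1 (zeta lam j))).+1.

(** The local condition at the box (l, k) *)

Variables (l k : nat).

Definition lower_row (j : nat) : nat :=
  if j == l then k else path_row j (l.-1, k).

Definition upper_row (j : nat) : nat :=
  if j == l then k.+1
  else if k < zeta lam l then path_row j (l, k.+1) else (zeta lam j).+1.

(* Paths list their boxes by increasing column, so the last box left of
   column l is the one in the largest column less than l. *)
Definition path_entry (j i : nat) : nat :=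
  if j == l then k
  else T (last (j, i) [seq b <- path_at j i | b.1 < l]).

(* The row index i ranges over [lower_row j, upper_row j - 1]; an interval
   [p, q] with p > q is empty. *)
Definition local_set (n : nat) (w : 'S_n) : pred nat :=
  [pred t | all (fun j =>
     has (fun i => path_entry j i <= t <= key_tableau lam w (j, i))
         (iota (lower_row j) (upper_row j - lower_row j)))
     (iota 1 l)].

End Scanning.

(* Main.v *)
Require Import Defs.
From mathcomp Require Import all_boot all_fingroup zify.
From Stdlib Require Import FunctionalExtensionality.

(** The columns of a skew tableau are recorded as a sequence of sets of letters.
    Raising such a sequence at i moves one letter from column i+1 to column i,
    chosen by the bracketing rule in which the letters of column i open and
    those of column i+1 close a bracket.  This is the crystal operator that
    keeps the Knuth class and changes the column lengths.

    Rectification is raising.  A hole that moves down leaves the columns alone,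
    and a hole that moves right performs a raise ([raisable_hole]).  Raising
    terminates, and it is confluent because two different raises of the same
    sequence can be completed to a common result ([local_confluence]).  So every
    sequence has a unique result that cannot be raised ([highest_unique]); as
    the sequences that cannot be raised are those of straight tableaux, a skew
    tableau rectifies to T if and only if its columns can be raised to those of
    T ([rectifies_toP]).

    Frank skew tableaux.  The sum of the squares of the column lengths does not
    decrease along a complete string of raises at i, and it is already maximal
    when the skew tableau is frank; hence such a string is empty or interchanges
    two adjacent column lengths ([extremal_pair]).  Sorting the lengths by
    such interchanges ends at T.  Read backwards, the rightmost column is
    obtained from a column j of T by exchanging it with one column after the
    other to its right ([extremal_last_column]), and one exchange is given by
    an explicit formula ([swapped]).  Carrying out these exchanges and pulling
    the columns apart into a disconnected skew diagram shows that the frank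
    skew tableaux asked for exist ([right_key_witness_exists]).

    Scanning is exchanging.  Extending all paths of column j by their boxes in
    the next column is a greedy matching, and the counting function of its
    result satisfies the same formula ([greedy_swapped]).  So column j of the
    right key consists of the last entries of the paths P(T; j, i)
    ([rightmost_tips]), and T is a Demazure tableau if and only if each of them
    is at most Y(w; j, i) ([demazure_path_ends]).

    The local condition.  The rows i from a(j) to b(j) - 1 include those of all
    paths formed while (l, k) is the bottom box of column l, and the first such
    path whose entry E(l, k; j, i) is at most T(l, k) takes the box.  Hence the
    path through (l, k) has the largest i in that range with E(l, k; j, i) at
    most T(l, k), and since Y(w; j, i) increases with i the condition says that
    T(l, k) is at most Y(w; j, i) for that i ([mem_local_set]).
    Entries increase along paths, so it is enough to know this at their last
    boxes. *)

Set Implicit Arguments.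
Unset Strict Implicit.
Unset Printing Implicit Defensive.

(** * Arrangements of letters in columns and their raises *)

(** The letters of each column, as a predicate.  Columns are numbered from 0
    here, so that column j belongs to the column j+1 of a tableau. *)
Definition arrangement : Type := nat -> nat -> bool.

Definition cnt (x : arrangement) (j v : nat) : nat := \sum_(u < v) x j u.

Lemma cnt0 x j : cnt x j 0 = 0.
Proof. by rewrite /cnt big_ord0. Qed.

Lemma cntS x j v : cnt x j v.+1 = cnt x j v + x j v.
Proof. by rewrite /cnt big_ord_recr. Qed.

Lemma cnt_inj x y : (forall j v, cnt x j v = cnt y j v) -> x = y.
Proof.
move=> eq_xy; apply: functional_extensionality => j.
apply: functional_extensionality => v.
have := eq_xy j v.+1; rewrite !cntS eq_xy => /addnI.
by case: (x j v); case: (y j v).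
Qed.

Definition shift_left (i b : nat) (x : arrangement) : arrangement :=
  fun j v => if j == i then x j v || (v == b)
             else if j == i.+1 then x j v && (v != b) else x j v.

(** Write H for cnt_i - cnt_{i+1}.  The condition is that H attains its minimum
    for the first time just after the letter b, which is the bracketing rule:
    b is the last letter of column i+1 that is matched by no letter of
    column i. *)
Definition raisable (i b : nat) (x : arrangement) : Prop :=
  (forall u, cnt x i b.+1 + cnt x i.+1 u <= cnt x i u + cnt x i.+1 b.+1) /\
  (forall u, u <= b ->
     cnt x i b.+1 + cnt x i.+1 u < cnt x i u + cnt x i.+1 b.+1).

(** H drops when it passes the letter b of its first minimum. *)
Lemma raisable_letter i b x : raisable i b x -> ~~ x i b /\ x i.+1 b.
Proof.
by case=> _ /(_ b (leqnn b)); rewrite !cntS; case: (x i b); case: (x i.+1 b); lia.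
Qed.

Lemma cnt_shift_left i b x j v :
  ~~ x i b -> x i.+1 b ->
  cnt (shift_left i b x) j v + ((j == i.+1) && (b < v))
    = cnt x j v + ((j == i) && (b < v)).
Proof.
move=> xib xi1b; elim: v => [|v IHv]; first by rewrite !cnt0 !andbF.
rewrite !cntS ltnS; move: (cnt (shift_left _ _ _) _ _) IHv => c.
rewrite /shift_left; have [->|ji] := eqVneq j i.
  have -> : (i == i.+1) = false by lia.
  have [->|vb] := eqVneq v b; first by rewrite (negbTE xib) ltnn leqnn; lia.
  by rewrite orbF; lia.
have [->|ji1] := eqVneq j i.+1; last by rewrite /= !addn0; lia.
have [->|vb] := eqVneq v b; first by rewrite xi1b ltnn leqnn; lia.
by rewrite andbT; lia.
Qed.

Lemma cnt_raise_l i b x v : raisable i b x ->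
  cnt (shift_left i b x) i v = cnt x i v + (b < v).
Proof.
move=> /raisable_letter[xi xi1].
by have := cnt_shift_left i v xi xi1; rewrite eqxx; case: (i =P i.+1); lia.
Qed.

Lemma cnt_raise_r i b x v : raisable i b x ->
  cnt (shift_left i b x) i.+1 v + (b < v) = cnt x i.+1 v.
Proof.
move=> /raisable_letter[xi xi1].
by have := cnt_shift_left i.+1 v xi xi1; rewrite eqxx; case: (i.+1 =P i); lia.
Qed.

Lemma cnt_raise_other i b x j v : j != i -> j != i.+1 ->
  cnt (shift_left i b x) j v = cnt x j v.
Proof.
move=> /negbTE ji /negbTE ji1; rewrite /cnt; apply: eq_bigr => u _.
by rewrite /shift_left ji ji1.
Qed.

Definition finite_support (M N : nat) (x : arrangement) : Prop :=
  forall j v, x j v -> j < M /\ v < N.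

Lemma cnt_big M N x j v : finite_support M N x -> N <= v -> cnt x j v = cnt x j N.
Proof.
move=> supp /subnK <-; elim: (v - N) => // d IHd.
by rewrite addSn cntS IHd; case: (boolP (x j (d + N))) => [/supp|]; lia.
Qed.

Lemma cnt_out M N x j v : finite_support M N x -> M <= j -> cnt x j v = 0.
Proof.
move=> supp le_Mj; rewrite /cnt big1 // => u _.
by case: (boolP (x j u)) => [/supp|]; lia.
Qed.

Lemma finite_support_raise M N i b x :
  finite_support M N x -> raisable i b x -> finite_support M N (shift_left i b x).
Proof.
move=> supp /raisable_letter[_ xi1b] j v; rewrite /shift_left.
have [-> /orP[/supp //|/eqP->]|_] := eqVneq j i; first by have := supp _ _ xi1b; lia.
by case: ifP => _ => [/andP[]|] /supp.
Qed.

Inductive steps : arrangement -> arrangement -> Prop :=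
| StepsRefl x : steps x x
| StepsRaise i b x y : raisable i b x -> steps (shift_left i b x) y -> steps x y.

Lemma steps_trans x y z : steps x y -> steps y z -> steps x z.
Proof. by elim=> // i b {}x {}y rx _ IH /IH; apply: StepsRaise. Qed.

Lemma steps1 i b x : raisable i b x -> steps x (shift_left i b x).
Proof. by move=> rx; apply: StepsRaise rx (StepsRefl _). Qed.

Lemma finite_support_steps M N x y :
  steps x y -> finite_support M N x -> finite_support M N y.
Proof.
by elim=> // i b {}x {}y rx _ IH supp; apply/IH/finite_support_raise.
Qed.

Lemma ex_first_min (f : nat -> nat) (m : nat) :
  exists2 p, p <= m & (forall u, u <= m -> f p <= f u) /\ (forall u, u < p -> f p < f u).
Proof.
elim: m => [|m [p pm [minp firstp]]].
  by exists 0 => //; split=> // u; rewrite leqn0 => /eqP->.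
have [le_f|lt_f] := leqP (f p) (f m.+1).
  exists p; first exact: leqW.
  by split=> // u; rewrite leq_eqVlt => /orP[/eqP->//|]; apply: minp.
exists m.+1 => //; split=> u.
  rewrite leq_eqVlt => /orP[/eqP->//|/minp]; exact: leq_trans (ltnW lt_f).
by rewrite ltnS => /minp; apply: leq_trans.
Qed.

(** The columns i and i+1, aligned at the top, have weakly increasing rows. *)
Definition pair_tableau (i : nat) (x : arrangement) : Prop :=
  forall v, cnt x i.+1 v <= cnt x i v.

(** The arrangements of straight tableaux are the highest weight elements of
    the crystal. *)
Definition highest (x : arrangement) : Prop := forall i, pair_tableau i x.

Lemma raisable_not_pair_tableau i b x : raisable i b x -> ~ pair_tableau i x.
Proof. by case=> _ /(_ 0 isT); rewrite !cnt0 => lt /(_ b.+1); lia. Qed.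

Lemma cnt_le x j v : cnt x j v <= v.
Proof. by elim: v => [|v IH]; rewrite ?cnt0 // cntS; case: (x j v); lia. Qed.

(** H vanishes at 0, so its first minimum is at 0 or just after a letter that
    can be raised. *)
Lemma pair_tableau_or_raisable M N i x : finite_support M N x ->
  pair_tableau i x \/ exists b, raisable i b x.
Proof.
move=> supp.
have [p pN [minp firstp]] :=
  ex_first_min (fun v => N + cnt x i v - cnt x i.+1 v) N.
have cap u : N + cnt x i (minn u N) - cnt x i.+1 (minn u N)
             = N + cnt x i u - cnt x i.+1 u.
  case: (leqP u N) => // Nu.
  by rewrite [cnt x i u](cnt_big _ supp (ltnW Nu))
             [cnt x i.+1 u](cnt_big _ supp (ltnW Nu)).
have bnd u : cnt x i.+1 u <= N.
  have [le|/ltnW le] := leqP u N; first by apply: leq_trans (cnt_le _ _ _) _.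
  by rewrite (cnt_big _ supp le) cnt_le.
have mina u : N + cnt x i p - cnt x i.+1 p <= N + cnt x i u - cnt x i.+1 u.
  by rewrite -[leqRHS]cap; apply: minp; apply: geq_minr.
case: p => [|b] in pN minp firstp mina *.
  by left=> v; have := mina v; have := bnd v; rewrite !cnt0; lia.
right; exists b; split=> u.
  by have := mina u; have := bnd u; have := bnd b.+1; lia.
by rewrite -ltnS => /firstp; have := bnd u; have := bnd b.+1; lia.
Qed.

(** * Confluence of raising *)

Definition joinable (y z : arrangement) : Prop :=
  exists2 w, steps y w & steps z w.

Lemma joinable_sym y z : joinable y z -> joinable z y.
Proof. by case=> w yw zw; exists w. Qed.

Lemma raisable_inj i b b' x : raisable i b x -> raisable i b' x -> b = b'.
Proof.
move=> [min first] [min' first']; case: (ltngtP b b') => // lt.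
  by have := first' b.+1 lt; have := min b'.+1; lia.
by have := first b'.+1 lt; have := min' b.+1; lia.
Qed.

Lemma raisable_ext i b x y :
  (forall v, cnt x i v = cnt y i v) -> (forall v, cnt x i.+1 v = cnt y i.+1 v) ->
  raisable i b x -> raisable i b y.
Proof.
by move=> ei ei1 [min first]; split=> u; rewrite -!ei -!ei1 //; apply: first.
Qed.

Lemma join_distant i b j c x : i.+1 < j ->
  raisable i b x -> raisable j c x ->
  joinable (shift_left i b x) (shift_left j c x).
Proof.
move=> lt_ij rb rc.
have rb' : raisable i b (shift_left j c x).
  by apply: raisable_ext rb => v; rewrite cnt_raise_other //; lia.
have rc' : raisable j c (shift_left i b x).
  by apply: raisable_ext rc => v; rewrite cnt_raise_other //; lia.
exists (shift_left j c (shift_left i b x)); first exact: steps1.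
suff -> : shift_left j c (shift_left i b x) = shift_left i b (shift_left j c x).
  exact: steps1.
apply: cnt_inj => k v; have [xi xi1] := raisable_letter rb.
have [xj xj1] := raisable_letter rc; have [yi yi1] := raisable_letter rb'.
have [yj yj1] := raisable_letter rc'.
have := cnt_shift_left k v xi xi1; have := cnt_shift_left k v xj xj1.
have := cnt_shift_left k v yi yi1; have := cnt_shift_left k v yj yj1.
lia.
Qed.

Lemma cnt_raise_lower_pair i b x : raisable i b x -> forall v,
  [/\ cnt (shift_left i b x) i v = cnt x i v + (b < v),
      cnt (shift_left i b x) i.+1 v + (b < v) = cnt x i.+1 v
    & cnt (shift_left i b x) i.+2 v = cnt x i.+2 v].
Proof.
move=> rb v; split; [exact: cnt_raise_l | exact: cnt_raise_r |].
by apply: cnt_raise_other; lia.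
Qed.

Lemma cnt_raise_upper_pair i c x : raisable i.+1 c x -> forall v,
  [/\ cnt (shift_left i.+1 c x) i v = cnt x i v,
      cnt (shift_left i.+1 c x) i.+1 v = cnt x i.+1 v + (c < v)
    & cnt (shift_left i.+1 c x) i.+2 v + (c < v) = cnt x i.+2 v].
Proof.
move=> rb v; split; [|exact: cnt_raise_l | exact: cnt_raise_r].
by apply: cnt_raise_other; lia.
Qed.

(** One of Stembridge's local relations.  Let H and K be the differences of the
    counting functions of columns i, i+1 and of columns i+1, i+2.  Raising b
    lowers K by one after b, so the first minimum of K stays at c unless K
    returns to its minimum after b.  In the first case the two raises commute.
    In the second case the next raise at i+1 moves another letter d, and the
    orders b, d, c, f and c, b, f, d lead to the same arrangement. *)
Lemma join_adjacent_gt M N i b c x : finite_support M N x -> c < b ->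
  raisable i b x -> raisable i.+1 c x ->
  joinable (shift_left i b x) (shift_left i.+1 c x).
Proof.
move=> supp lt_cb rb rc.
pose x1 := shift_left i b x; pose x2 := shift_left i.+1 c x.
have supp1 : finite_support M N x1 by apply: finite_support_raise.
have supp2 : finite_support M N x2 by apply: finite_support_raise.
have e1 := cnt_raise_lower_pair rb; have e2 := cnt_raise_upper_pair rc; rewrite -/x1 -/x2 in e1 e2 *.
have [minb firstb] := rb; have [minc firstc] := rc.
(* Raising c lowers H by one after c < b, which keeps its first minimum. *)
have rb2 : raisable i b x2.
  split=> u; have := minb u; have := firstb u; have [] := e2 u; have [] := e2 b.+1; lia.
pose x21 := shift_left i b x2; have e21 := cnt_raise_lower_pair rb2; rewrite -/x21 in e21.
have supp21 : finite_support M N x21 by apply: finite_support_raise.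
(* K is still negative after c, so that some letter d can be raised next. *)
have [/(_ c.+1)|[d rd]] := pair_tableau_or_raisable i.+1 supp1.
  by have := firstc 0; rewrite !cnt0; have [] := e1 c.+1; lia.
pose x1d := shift_left i.+1 d x1; have e1d := cnt_raise_upper_pair rd; rewrite -/x1d in e1d.
have [eq_dc|ne_dc] := eqVneq d c; first subst d.
  exists x1d; first exact: steps1.
  suff -> : x1d = x21 by exact: steps1.
  apply: cnt_inj => k v; have [e11 e12 e13] := e1 v; have [e31 e32 e33] := e1d v.
  have [e41 e42 e43] := e2 v; have [e51 e52 e53] := e21 v.
  have [->|ki] := eqVneq k i; first by lia.
  have [->|ki1] := eqVneq k i.+1; first by lia.
  have [->|ki2] := eqVneq k i.+2; first by lia.
  by rewrite /x1d /x21 !cnt_raise_other.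
have [mind firstd] := rd.
have le_bd : b <= d.
  have := firstd c.+1; have := mind c.+1; have := minc d.+1; have := firstc d.+1.
  have [] := e1 c.+1; have [] := e1 d.+1; lia.
have supp1d : finite_support M N x1d by apply: finite_support_raise.
have rc1d : raisable i.+1 c x1d.
  split=> u; have := firstc u; have := minc u; have := mind u; have := firstd u;
  have := mind c.+1; have := minc d.+1;
  have [] := e1d u; have [] := e1d c.+1; have [] := e1 u; have [] := e1 c.+1;
  have [] := e1 d.+1; lia.
pose x1dc := shift_left i.+1 c x1d; have e1dc := cnt_raise_upper_pair rc1d.
rewrite -/x1dc in e1dc.
(* H was one above its minimum just before b, and raising c turns this into
   the new minimum. *)
have [/(_ b)|[f rf]] := pair_tableau_or_raisable i supp21.
  have := firstb 0; have := firstb b; rewrite !cnt0 (cntS x i) (cntS x i.+1).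
  have [xib xi1b] := raisable_letter rb.
  by rewrite xi1b (negbTE xib); have [] := e21 b; have [] := e2 b; lia.
pose x21f := shift_left i f x21; have e21f := cnt_raise_lower_pair rf; rewrite -/x21f in e21f.
have [minf firstf] := rf.
have Hb : cnt x i b + cnt x i.+1 b.+1 = cnt x i b.+1 + cnt x i.+1 b + 1.
  have [xib xi1b] := raisable_letter rb; rewrite !cntS xi1b (negbTE xib); lia.
have lt_fb : f < b.
  have := minf b; have := firstf b; have := minb f.+1.
  have [] := e2 f.+1; have [] := e2 b; have [] := e21 b; have [] := e21 f.+1; lia.
have le_cf : c <= f.
  have := minf b; have := firstf b; have := minb f.+1; have := firstb f.+1.
  have [] := e2 f.+1; have [] := e2 b; have [] := e21 b; have [] := e21 f.+1; lia.
have rd21f : raisable i.+1 d x21f.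
  split=> u; have := mind u; have := firstd u; have := minc u; have := firstc u;
  have := mind c.+1; have := firstd c.+1; have := minc d.+1;
  have [] := e1 u; have [] := e1 d.+1; have [] := e1 c.+1;
  have [] := e2 u; have [] := e21 u; have [] := e21f u;
  have [] := e2 d.+1; have [] := e21 d.+1; have [] := e21f d.+1; lia.
have rf1dc : raisable i f x1dc.
  split=> u; have := minf u; have := firstf u; have := minb u; have := firstb u;
  have := minf b; have := minb f.+1;
  have [] := e1 u; have [] := e1d u; have [] := e1dc u;
  have [] := e1 f.+1; have [] := e1d f.+1; have [] := e1dc f.+1;
  have [] := e2 u; have [] := e21 u; have [] := e2 f.+1; have [] := e21 f.+1; 
  have [] := e2 b; have [] := e21 b; lia.
exists (shift_left i f x1dc).
  by apply: StepsRaise rd _; apply: StepsRaise rc1d _; apply: steps1.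
suff -> : shift_left i f x1dc = shift_left i.+1 d x21f.
  by apply: StepsRaise rb2 _; apply: StepsRaise rf _; apply: steps1.
apply: cnt_inj => k v; have [e11 e12 e13] := e1 v; have [e31 e32 e33] := e1d v.
have [e41 e42 e43] := e2 v; have [e51 e52 e53] := e21 v.
have [e61 e62 e63] := e1dc v; have [e71 e72 e73] := e21f v.
have [e81 e82 e83] := cnt_raise_lower_pair rf1dc v.
have [e91 e92 e93] := cnt_raise_upper_pair rd21f v.
have [->|ki] := eqVneq k i; first by lia.
have [->|ki1] := eqVneq k i.+1; first by lia.
have [->|ki2] := eqVneq k i.+2; first by lia.
by rewrite /x1dc /x21f /x1d /x21 /x1 /x2 !cnt_raise_other.
Qed.
(** The relation for the opposite order of the two letters.  Now raising c
    lowers nothing before c and may create a new first minimum d of H after it;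
    if it does, the orders b, c, g, d and c, d, b, g agree. *)
Lemma join_adjacent_lt M N i b c x : finite_support M N x -> b < c ->
  raisable i b x -> raisable i.+1 c x ->
  joinable (shift_left i b x) (shift_left i.+1 c x).
Proof.
move=> supp lt_bc rb rc.
pose x1 := shift_left i b x; pose x2 := shift_left i.+1 c x.
have supp1 : finite_support M N x1 by apply: finite_support_raise.
have supp2 : finite_support M N x2 by apply: finite_support_raise.
have e1 := cnt_raise_lower_pair rb; have e2 := cnt_raise_upper_pair rc; rewrite -/x1 -/x2 in e1 e2 *.
have [minb firstb] := rb; have [minc firstc] := rc.
(* Raising b lowers K by one after b < c, which keeps its first minimum. *)
have rc1 : raisable i.+1 c x1.
  split=> u; have := minc u; have := firstc u; have [] := e1 u; have [] := e1 c.+1; lia.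
pose x12 := shift_left i.+1 c x1; have e12 := cnt_raise_upper_pair rc1; rewrite -/x12 in e12.
have supp12 : finite_support M N x12 by apply: finite_support_raise.
(* H is still negative after b, so that some letter d can be raised next. *)
have [/(_ b.+1)|[d rd]] := pair_tableau_or_raisable i supp2.
  by have := firstb 0; rewrite !cnt0; have [] := e2 b.+1; lia.
pose x2d := shift_left i d x2; have e2d := cnt_raise_lower_pair rd; rewrite -/x2d in e2d.
have [eq_db|ne_db] := eqVneq d b; first subst d.
  exists x12; first exact: steps1.
  suff -> : x12 = x2d by exact: steps1.
  apply: cnt_inj => k v; have [e11 e12' e13] := e1 v; have [e31 e32 e33] := e2d v.
  have [e41 e42 e43] := e2 v; have [e51 e52 e53] := e12 v.
  have [->|ki] := eqVneq k i; first by lia.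
  have [->|ki1] := eqVneq k i.+1; first by lia.
  have [->|ki2] := eqVneq k i.+2; first by lia.
  by rewrite /x12 /x2d !cnt_raise_other.
have [mind firstd] := rd.
have le_cd : c <= d.
  have := firstd b.+1; have := mind b.+1; have := minb d.+1; have := firstb d.+1.
  have [] := e2 b.+1; have [] := e2 d.+1; lia.
have supp2d : finite_support M N x2d by apply: finite_support_raise.
have rb2d : raisable i b x2d.
  split=> u; have := firstb u; have := minb u; have := mind u; have := firstd u;
  have := mind b.+1; have := minb d.+1;
  have [] := e2d u; have [] := e2d b.+1; have [] := e2 u; have [] := e2 b.+1;
  have [] := e2 d.+1; lia.
pose x2db := shift_left i b x2d; have e2db := cnt_raise_lower_pair rb2d.
rewrite -/x2db in e2db.
have Hc : cnt x i.+1 c + cnt x i.+2 c.+1 = cnt x i.+1 c.+1 + cnt x i.+2 c + 1.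
  have [xib xi1b] := raisable_letter rc; rewrite !cntS xi1b (negbTE xib); lia.
(* K was one above its minimum just before c, and raising b turns this into
   the new minimum. *)
have [/(_ c)|[g rg]] := pair_tableau_or_raisable i.+1 supp12.
  have := firstc 0; rewrite !cnt0.
  by have [] := e12 c; have [] := e1 c; lia.
pose x12g := shift_left i.+1 g x12; have e12g := cnt_raise_upper_pair rg; rewrite -/x12g in e12g.
have [ming firstg] := rg.
have lt_gc : g < c.
  have := ming c; have := firstg c; have := minc g.+1.
  have [] := e1 g.+1; have [] := e1 c; have [] := e12 c; have [] := e12 g.+1; lia.
have le_bg : b <= g.
  have := ming c; have := firstg c; have := minc g.+1; have := firstc g.+1.
  have [] := e1 g.+1; have [] := e1 c; have [] := e12 c; have [] := e12 g.+1; lia.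
have rd12g : raisable i d x12g.
  split=> u; have := mind u; have := firstd u; have := minb u; have := firstb u;
  have := mind b.+1; have := firstd b.+1; have := minb d.+1;
  have [] := e2 u; have [] := e2 d.+1; have [] := e2 b.+1;
  have [] := e1 u; have [] := e12 u; have [] := e12g u;
  have [] := e1 d.+1; have [] := e12 d.+1; have [] := e12g d.+1; lia.
have rg2db : raisable i.+1 g x2db.
  split=> u; have := ming u; have := firstg u; have := minc u; have := firstc u;
  have := ming c; have := minc g.+1;
  have [] := e2 u; have [] := e2d u; have [] := e2db u;
  have [] := e2 g.+1; have [] := e2d g.+1; have [] := e2db g.+1;
  have [] := e1 u; have [] := e12 u; have [] := e1 g.+1; have [] := e12 g.+1; 
  have [] := e1 c; have [] := e12 c; lia.
exists (shift_left i d x12g).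
  by apply: StepsRaise rc1 _; apply: StepsRaise rg _; apply: steps1.
suff -> : shift_left i d x12g = shift_left i.+1 g x2db.
  by apply: StepsRaise rd _; apply: StepsRaise rb2d _; apply: steps1.
apply: cnt_inj => k v; have [e11 e12' e13] := e1 v; have [e31 e32 e33] := e2d v.
have [e41 e42 e43] := e2 v; have [e51 e52 e53] := e12 v.
have [e61 e62 e63] := e2db v; have [e71 e72 e73] := e12g v.
have [e81 e82 e83] := cnt_raise_lower_pair rd12g v.
have [e91 e92 e93] := cnt_raise_upper_pair rg2db v.
have [->|ki] := eqVneq k i; first by lia.
have [->|ki1] := eqVneq k i.+1; first by lia.
have [->|ki2] := eqVneq k i.+2; first by lia.
by rewrite /x2db /x12g /x2d /x12 /x1 /x2 !cnt_raise_other.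
Qed.

Lemma local_confluence M N i b j c x : finite_support M N x ->
  raisable i b x -> raisable j c x ->
  joinable (shift_left i b x) (shift_left j c x).
Proof.
move=> supp; wlog le_ij : i b j c / i <= j => [wlog_ij|rb rc].
  case: (leqP i j) => [|/ltnW] le_ij rb rc; first exact: wlog_ij.
  by apply: joinable_sym; apply: wlog_ij.
case: (ltnP i.+1 j) => [lt_ij|le_ji]; first exact: join_distant.
have [eq_ji|ne_ji] := eqVneq j i.
  subst j; rewrite (raisable_inj rb rc).
  by exists (shift_left i c x); apply: StepsRefl.
have eq_ji : j = i.+1 by lia.
subst j; case: (ltngtP b c) => [lt_bc|lt_cb|eq_bc].
- exact: join_adjacent_lt supp lt_bc rb rc.
- exact: join_adjacent_gt supp lt_cb rb rc.
have [_ xb] := raisable_letter rb; have [] := raisable_letter rc.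
by rewrite -eq_bc xb.
Qed.

(** A raise moves one letter one column to the left and so decreases this
    number by one, which makes raising terminate. *)
Definition column_weight (M N : nat) (x : arrangement) : nat :=
  \sum_(j < M) j * cnt x j N.

Lemma big_split_adjacent (F : nat -> nat) M i : i.+1 < M ->
  \sum_(j < M) F j
    = F i + F i.+1 + \sum_(j < M | (j != i :> nat) && (j != i.+1 :> nat)) F j.
Proof.
move=> lt_iM.
rewrite (bigD1 (Ordinal (ltnW lt_iM))) //= (bigD1 (Ordinal lt_iM)) /=; last first.
  by rewrite -val_eqE /=; lia.
rewrite addnA; congr (_ + _ + _); exact: eq_bigl.
Qed.

Lemma column_weight_raise M N i b x : finite_support M N x -> raisable i b x ->
  column_weight M N x = (column_weight M N (shift_left i b x)).+1.
Proof.
move=> supp rb; have [_ /supp[lt_iM lt_bN]] := raisable_letter rb.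
rewrite /column_weight !(big_split_adjacent (fun j => j * cnt _ j N) lt_iM).
have := cnt_raise_l N rb; have := cnt_raise_r N rb; rewrite lt_bN.
set rest := (X in _ = (_ + X).+1); suff -> : 
  \sum_(j < M | (j != i :> nat) && (j != i.+1 :> nat)) j * cnt x j N = rest by nia.
by apply: eq_bigr => j /andP[ji ji1]; rewrite cnt_raise_other.
Qed.

Lemma not_highest_raisable M N x : finite_support M N x ->
  highest x \/ exists i b, raisable i b x.
Proof.
move=> supp.
have [hw|[i not_i]] : highest x \/ exists i, ~ pair_tableau i x.
- case: (boolP [forall i : 'I_M, [forall v : 'I_N.+1, cnt x i.+1 v <= cnt x i v]]).
    move=> /forallP hw; left=> i v; case: (leqP M i) => [le_Mi|lt_iM].
      by rewrite (cnt_out _ supp) //; lia.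
    have /forallP {}hw := hw (Ordinal lt_iM).
    case: (leqP v N) => [le_vN|/ltnW le_Nv].
      by have := hw (Ordinal (le_vN : v < N.+1)).
    by rewrite !(cnt_big _ supp le_Nv); apply: (hw ord_max).
  move=> /forallPn[i /forallPn[v not_le]]; right; exists i => /(_ v).
  by apply/negP.
- by left.
by case: (pair_tableau_or_raisable i supp) => // [[b rb]]; right; exists i, b.
Qed.

Lemma steps_highest M N x : finite_support M N x ->
  exists2 y, steps x y & highest y.
Proof.
move=> supp; move: {2}(column_weight M N x) (erefl (column_weight M N x)) => m.
elim: m x supp => [|m IHm] x supp weight_x;
  (have [hx|[i [b rb]]] := not_highest_raisable supp;
    first by exists x => //; apply: StepsRefl).
  by have := column_weight_raise supp rb; rewrite weight_x.
have [||y xy hy] := IHm (shift_left i b x).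
- exact: finite_support_raise.
- by have := column_weight_raise supp rb; rewrite weight_x => -[].
by exists y => //; apply: StepsRaise rb xy.
Qed.

Lemma steps_from_highest x y : steps x y -> highest x -> y = x.
Proof. by case=> // i b {}x {}y /raisable_not_pair_tableau not_i _ /(_ i). Qed.

(** Newman's lemma, by induction on the column weight. *)
Lemma highest_unique M N x y z : finite_support M N x ->
  steps x y -> highest y -> steps x z -> highest z -> y = z.
Proof.
move=> supp; move: {2}(column_weight M N x) (erefl (column_weight M N x)) => m.
elim/ltn_ind: m x y z supp => m IHm x y z supp weight_x xy hy xz hz.
case: xy supp weight_x hy xz => [{}x|i b {}x {}y rb by_]; first move=> _ _ hx xz.
  by rewrite (steps_from_highest xz hx).
move=> supp weight_x hy xz; case: xz supp weight_x hz rb by_ => [{}x|j c {}x {}z rc cz].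
  by move=> _ _ hx rb; have := raisable_not_pair_tableau rb (hx i).
move=> supp weight_x hz rb by_.
have [w yw zw] := local_confluence supp rb rc.
have suppb := finite_support_raise supp rb; have suppc := finite_support_raise supp rc.
have weight_b := column_weight_raise supp rb; have weight_c := column_weight_raise supp rc.
have [t wt ht] := steps_highest (finite_support_steps yw suppb).
transitivity t.
  by apply: (IHm _ _ _ _ _ suppb erefl) => //; [lia | exact: steps_trans yw wt].
by apply: (IHm _ _ _ _ _ suppc erefl) => //; [lia | exact: steps_trans zw wt].
Qed.

(** * Strings of raises *)

Inductive raises (i : nat) : nat -> arrangement -> arrangement -> Prop :=
| Raises0 x : raises i 0 x x
| RaisesS b k x y :
    raisable i b x -> raises i k (shift_left i b x) y -> raises i k.+1 x y.

Lemma raises_steps i k x y : raises i k x y -> steps x y.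
Proof. by elim=> [z|b {}k {}x {}y rb _]; [exact: StepsRefl | exact: StepsRaise]. Qed.

Lemma raises_rcons i k b x y :
  raises i k x y -> raisable i b y -> raises i k.+1 x (shift_left i b y).
Proof.
elim=> [z rb|c {}k {}x {}y rc _ IH /IH]; last exact: RaisesS.
exact: RaisesS rb (Raises0 _ _).
Qed.

Lemma raises_other i k (x y : arrangement) j :
  raises i k x y -> j != i -> j != i.+1 -> y j = x j.
Proof.
elim=> // b {}k {}x {}y _ _ IH ji ji1; rewrite IH // /shift_left.
by rewrite (negbTE ji) (negbTE ji1).
Qed.

Lemma cnt_col (x y : arrangement) i j v : x i = y j -> cnt x i v = cnt y j v.
Proof. by rewrite /cnt => ->. Qed.

Lemma raises_cnt M N i k x y : raises i k x y -> finite_support M N x ->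
  cnt y i N = cnt x i N + k /\ cnt y i.+1 N + k = cnt x i.+1 N.
Proof.
elim=> [z|b {}k {}x {}y rb _ IH supp]; first by rewrite !addn0.
have [] := IH (finite_support_raise supp rb).
have := cnt_raise_l N rb; have := cnt_raise_r N rb.
by have [_ /supp[_ ->]] := raisable_letter rb; lia.
Qed.

(** The minimum of cnt_i - cnt_{i+1} increases by exactly one with each raise,
    and it is zero at the end of a complete string. *)
Lemma raises_depth i k x y : raises i k x y -> pair_tableau i y ->
  forall v, cnt x i.+1 v <= cnt x i v + k.
Proof.
elim=> [z|b {}k {}x {}y rb _ IH] ty v; first by rewrite addn0.
have [minb _] := rb; have [xi xi1] := raisable_letter rb.
have := IH ty b; have := cnt_raise_l b rb; have := cnt_raise_r b rb.
by have := minb v; rewrite ltnn !cntS xi1 (negbTE xi); lia.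
Qed.

Lemma top_of_string M N i x : finite_support M N x ->
  exists k y, raises i k x y /\ pair_tableau i y.
Proof.
move=> supp; move: {2}(column_weight M N x) (erefl (column_weight M N x)) => m.
elim: m x supp => [|m IHm] x supp weight_x;
  (have [tx|[b rb]] := pair_tableau_or_raisable i supp;
    first by exists 0, x; split=> //; apply: Raises0).
  by have := column_weight_raise supp rb; rewrite weight_x.
have [||k [y [xy ty]]] := IHm (shift_left i b x).
- exact: finite_support_raise.
- by have := column_weight_raise supp rb; rewrite weight_x => -[].
by exists k.+1, y; split=> //; apply: RaisesS rb xy.
Qed.

(** The exchange of the lengths of two adjacent columns: a and b are the
    counting functions of the left and right column of a two-column tableau.
    The letters of the left column that match no letter of the right one move to
    the right, and min_(w >= v) (a w - b w) of them are smaller than v.  So c is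
    the counting function of the new right column. *)
Definition swapped (a b c : nat -> nat) : Prop := forall v,
  (forall w, v <= w -> c v + b w <= b v + a w) /\
  (exists2 w, v <= w & c v + b w = b v + a w).

Lemma swapped_inj a b c c' : swapped a b c -> swapped a b c' -> c =1 c'.
Proof.
move=> sc sc' v; have [lec [w vw eqc]] := sc v; have [lec' [w' vw' eqc']] := sc' v.
by have := lec w' vw'; have := lec' w vw; lia.
Qed.

Lemma swapped_ext a a' b b' c c' : a =1 a' -> b =1 b' -> c =1 c' ->
  swapped a b c -> swapped a' b' c'.
Proof.
move=> ea eb ec s v; have [le [w vw eq]] := s v; split.
  by move=> u; rewrite -ea -!eb -ec; apply: le.
by exists w => //; rewrite -ea -!eb -ec.
Qed.

(** Each raise increases by one the minimum over w >= v of
    b v + a w - b w, where a and b count in columns i and i+1. *)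
Lemma raises_shifted_min i k x y c : raises i k x y ->
  (forall v, (forall w, v <= w -> c v + cnt x i.+1 w <= cnt x i.+1 v + cnt x i w + k) /\
   (exists2 w, v <= w & c v + cnt x i.+1 w = cnt x i.+1 v + cnt x i w + k)) ->
  swapped (cnt y i) (cnt y i.+1) c.
Proof.
elim=> [z swap v|b {}k {}x {}y rb _ IH swap].
  have [le [w vw eq]] := swap v; split=> [u /le|]; first by rewrite addn0.
  by exists w => //; rewrite eq addn0.
apply: IH => v; have [le [w vw eq]] := swap v.
have [minb firstb] := rb; have [xi xi1] := raisable_letter rb.
have el := fun u => cnt_raise_l u rb; have er := fun u => cnt_raise_r u rb.
split=> [u vu|].
  have := le u vu; have := el u; have := er u; have := er v; have := minb u.
  have [lt_vb1|] := leqP v b; last by lia.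
  have := le b.+1 (leqW lt_vb1); case: (leqP u b) => [/firstb|]; lia.
have [le_vb|lt_bv] := leqP v b.
  exists b => //; have := el b; have := er b; have := er v; rewrite ltnn.
  have := le b.+1 (leqW le_vb); have := minb w; rewrite !cntS xi1 (negbTE xi).
  by lia.
by exists w => //; have := el w; have := er w; have := er v; lia.
Qed.

(** If the string interchanges the two lengths, then a w - b w attains its
    minimum -k at all large w, so the minimum of b v + a w - b w + k over
    w >= v is b v. *)
Lemma raises_swapped M N i k x y : finite_support M N x ->
  raises i k x y -> pair_tableau i y -> cnt x i.+1 N = cnt x i N + k ->
  swapped (cnt y i) (cnt y i.+1) (cnt x i.+1).
Proof.
move=> supp xy ty eqN; have depth := raises_depth xy ty.
apply: (raises_shifted_min xy) => v; split=> [w _|].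
  by have := depth w; lia.
exists (maxn v N); first exact: leq_maxl.
by rewrite !(cnt_big _ supp (leq_maxr v N)); lia.
Qed.

Lemma ex_last_min (f : nat -> nat) (m : nat) :
  exists2 p, p <= m & (forall u, u <= m -> f p <= f u) /\
                      (forall u, p < u -> u <= m -> f p < f u).
Proof.
have [q qm [minq firstq]] := ex_first_min (fun u => f (m - u)) m.
exists (m - q); first exact: leq_subr.
split=> [u um|u lt_qu um].
  by have := minq (m - u) (leq_subr _ _); rewrite subKn.
by have := firstq (m - u); rewrite subKn //; apply; lia.
Qed.

Definition shift_right (i b : nat) (x : arrangement) : arrangement :=
  fun j v => if j == i then x j v && (v != b)
             else if j == i.+1 then x j v || (v == b) else x j v.

Lemma shift_rightK i b (x : arrangement) : x i b -> ~~ x i.+1 b ->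
  shift_left i b (shift_right i b x) = x.
Proof.
move=> xi xi1; apply: functional_extensionality => j.
apply: functional_extensionality => v; rewrite /shift_left /shift_right.
have [->|_] := eqVneq j i.
  by have [->|_] := eqVneq v b; rewrite ?xi ?orbT // andbT orbF.
have [->|_] := eqVneq j i.+1 => //.
by have [->|_] := eqVneq v b; rewrite ?(negbTE xi1) ?andbF // orbF andbT.
Qed.

Lemma finite_support_shift_right M N i b x : finite_support M N x ->
  i.+1 < M -> x i b -> finite_support M N (shift_right i b x).
Proof.
move=> supp lt_iM xi j v; rewrite /shift_right.
have [-> /andP[/supp //]|_] := eqVneq j i.
have [-> /orP[/supp //|/eqP->]|_] := eqVneq j i.+1; last exact: supp.
by have [] := supp _ _ xi.
Qed.

(** The inverse of a raise moves the letter at which cnt_i - cnt_{i+1} leaves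
    its minimum for the last time. *)
Lemma lowering_exists M N i v y : finite_support M N y -> i.+1 < M ->
  cnt y i v + cnt y i.+1 N < cnt y i N + cnt y i.+1 v ->
  exists x b, [/\ finite_support M N x, raisable i b x & y = shift_left i b x].
Proof.
move=> supp lt_iM lt_v.
have bnd u : cnt y i.+1 u <= N.
  have [le|/ltnW le] := leqP u N; first by apply: leq_trans (cnt_le _ _ _) _.
  by rewrite (cnt_big _ supp le) cnt_le.
have [p pN [minp lastp]] :=
  ex_last_min (fun v => N + cnt y i v - cnt y i.+1 v) N.
have lt_pN : p < N.
  rewrite ltn_neqAle pN andbT; apply/eqP => eq_pN; move: lt_v.
  case: (leqP v N) => [/minp|/ltnW le_Nv]; last by rewrite !(cnt_big _ supp le_Nv); lia.
  by have := bnd v; have := bnd p; rewrite eq_pN; lia.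
have minp' u : cnt y i p + cnt y i.+1 u <= cnt y i u + cnt y i.+1 p.
  case: (leqP u N) => [/minp|/ltnW le_Nu]; first by have := bnd u; have := bnd p; lia.
  rewrite !(cnt_big _ supp le_Nu); have := minp _ (leqnn N).
  by have := bnd N; have := bnd p; lia.
have lastp' u : p < u -> cnt y i p + cnt y i.+1 u < cnt y i u + cnt y i.+1 p.
  case: (leqP u N) => [uN /lastp/(_ uN)|/ltnW le_Nu _].
    by have := bnd u; have := bnd p; lia.
  rewrite !(cnt_big _ supp le_Nu); have := lastp _ lt_pN (leqnn N).
  by have := bnd N; have := bnd p; lia.
have [yi yi1] : y i p /\ ~~ y i.+1 p.
  by have := lastp' _ (ltnSn p); rewrite !cntS; case: (y i p); case: (y i.+1 p); lia.
exists (shift_right i p y), p; split.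
- exact: finite_support_shift_right.
- have xi : ~~ shift_right i p y i p by rewrite /shift_right eqxx eqxx andbF.
  have xi1 : shift_right i p y i.+1 p.
    by rewrite /shift_right (eqxx i.+1) eqxx orbT; case: (i.+1 =P i) => //; lia.
  have el u : cnt y i u = cnt (shift_right i p y) i u + (p < u).
    have := cnt_shift_left i u xi xi1; rewrite shift_rightK // eqxx.
    by case: (i =P i.+1); lia.
  have er u : cnt y i.+1 u + (p < u) = cnt (shift_right i p y) i.+1 u.
    have := cnt_shift_left i.+1 u xi xi1; rewrite shift_rightK // eqxx.
    by case: (i.+1 =P i); lia.
  have H : cnt y i p.+1 + cnt y i.+1 p = cnt y i p + cnt y i.+1 p.+1 + 1.
    by rewrite !cntS yi (negbTE yi1); lia.
  split=> u.
    have := minp' u; have := el u; have := er u; have := el p.+1; have := er p.+1.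
    by case: (ltnP p u) => [/lastp'|]; lia.
  have := minp' u; have := el u; have := er u; have := el p.+1; have := er p.+1.
  by lia.
- by rewrite shift_rightK.
Qed.

(** A lowering decreases the last value of cnt_i - cnt_{i+1} by two and its
    minimum by one, so k of them make the last value the minimum. *)
Lemma lower_string_to_min M N i k y : finite_support M N y -> i.+1 < M ->
  (forall v, cnt y i N + cnt y i.+1 v <= cnt y i v + cnt y i.+1 N + k) ->
  (exists v, cnt y i N + cnt y i.+1 v = cnt y i v + cnt y i.+1 N + k) ->
  exists2 x, finite_support M N x & raises i k x y.
Proof.
move=> supp lt_iM; elim: k y supp => [|k IHk] y supp le_k [v0 eq_k].
  by exists y => //; apply: Raises0.
have [|x [b [suppx rb yx]]] := @lowering_exists M N i v0 y supp lt_iM; first by lia.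
have [_ /suppx[_ lt_bN]] := raisable_letter rb.
have el := fun u => cnt_raise_l u rb; have er := fun u => cnt_raise_r u rb.
rewrite -yx in el er; have [minb firstb] := rb; have [xi xi1] := raisable_letter rb.
have [||z suppz zx] := IHk x suppx.
- move=> v; have := el v; have := er v; have := el N; have := er N.
  have := le_k v; have := minb v; have := le_k b.
  have := el b; have := er b; rewrite !ltnn lt_bN.
  by move: minb => /(_ v); rewrite !cntS xi1 (negbTE xi); lia.
- exists b.+1; have := el v0; have := er v0; have := el N; have := er N.
  have := el b; have := er b; rewrite !ltnn lt_bN.
  have := minb v0; have := le_k b; have := firstb v0.
  by rewrite !cntS xi1 (negbTE xi); lia.
by exists z => //; rewrite yx; apply: raises_rcons.
Qed.

Lemma lower_string M N i y : finite_support M N y -> i.+1 < M ->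
  pair_tableau i y -> exists x,
  [/\ finite_support M N x, raises i (cnt y i N - cnt y i.+1 N) x y,
      cnt x i N = cnt y i.+1 N & cnt x i.+1 N = cnt y i N].
Proof.
move=> supp lt_iM ty; have tN := ty N.
have [||x suppx xy] := @lower_string_to_min M N i (cnt y i N - cnt y i.+1 N) y supp lt_iM.
- by move=> v; have := ty v; lia.
- by exists 0; rewrite !cnt0; lia.
by exists x; have [] := raises_cnt xy suppx; split=> //; lia.
Qed.

(** * Extremal arrangements and their last column *)

Definition sumsq (M N : nat) (x : arrangement) : nat :=
  \sum_(j < M) cnt x j N ^ 2.

Lemma raises0_inv i x y : raises i 0 x y -> x = y.
Proof. by move=> xy; inversion xy. Qed.

Lemma raises_inner M N i k x y : finite_support M N x -> raises i k.+1 x y -> i.+1 < M.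
Proof. by move=> supp xy; inversion xy; have [_ /supp[]] := raisable_letter H0. Qed.

(** Moving k letters adds 2k(k + cnt_i - cnt_{i+1}) to the sum of the squares,
    and a complete string has k >= cnt_{i+1} - cnt_i. *)
Lemma sumsq_raises M N i k x y : finite_support M N x ->
  raises i k x y -> pair_tableau i y ->
  sumsq M N x <= sumsq M N y ?= iff ((k == 0) || (cnt x i.+1 N == cnt x i N + k)).
Proof.
move=> supp; case: k => [|k] xy ty.
  by rewrite (raises0_inv xy); split; rewrite ?leqnn ?eqxx.
have lt_iM := raises_inner supp xy.
have le_k := raises_depth xy ty N; have [eq_l eq_r] := raises_cnt xy supp.
rewrite /sumsq !(big_split_adjacent (fun j => cnt _ j N ^ 2) lt_iM).
have -> : \sum_(j < M | (j != i :> nat) && (j != i.+1 :> nat)) cnt y j N ^ 2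
        = \sum_(j < M | (j != i :> nat) && (j != i.+1 :> nat)) cnt x j N ^ 2.
  by apply: eq_bigr => j /andP[ji ji1]; rewrite (cnt_col _ (raises_other xy ji ji1)).
move: (\sum_(j < M | _) _) => s.
by rewrite eq_l -eq_r; split; [nia | apply/eqP/eqP => ?; nia].
Qed.

(** A sequence of complete strings leads from x to t. *)
Lemma sumsq_le M N x t : finite_support M N x -> steps x t -> highest t ->
  sumsq M N x <= sumsq M N t.
Proof.
move=> supp; move: {2}(column_weight M N x) (erefl (column_weight M N x)) => m.
elim/ltn_ind: m x supp => m IHm x supp weight_x xt ht.
have [hx|[i [b rb]]] := not_highest_raisable supp.
  by rewrite (steps_from_highest xt hx).
have [k [y [xy ty]]] := top_of_string i supp.
have suppy := finite_support_steps (raises_steps xy) supp.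
have yt : steps y t.
  have [w yw hw] := steps_highest suppy.
  have xw := steps_trans (raises_steps xy) yw.
  by rewrite (highest_unique supp xt ht xw hw).
have [le_xy _] := sumsq_raises supp xy ty; apply: leq_trans le_xy _.
apply: (IHm _ _ _ suppy erefl) => //.
case: k xy => [xy|k xy].
  by have := raisable_not_pair_tableau rb; rewrite (raises0_inv xy).
inversion xy; subst.
rewrite (column_weight_raise supp H0).
have le_weight u v : finite_support M N u -> steps u v ->
    column_weight M N v <= column_weight M N u.
  move=> suppu uv; elim: uv suppu => // i' b' {}u {}v ru _ IH suppu.
  by rewrite (column_weight_raise suppu ru); apply/leqW/IH/finite_support_raise.
by rewrite ltnS; apply: le_weight (raises_steps H1); apply: finite_support_raise.
Qed.

(** These are the x with the column lengths of t in some order, for which the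
    bound of [sumsq_le] is attained. *)
Definition extremal (M N : nat) (t x : arrangement) : Prop :=
  [/\ finite_support M N x, steps x t, highest t & sumsq M N x = sumsq M N t].

Lemma extremal_pair M N t x i : extremal M N t x ->
  exists k y, [/\ raises i k x y, pair_tableau i y, extremal M N t y &
                  k = 0 \/ cnt x i.+1 N = cnt x i N + k].
Proof.
case=> supp xt ht sq_x; have [k [y [xy ty]]] := top_of_string i supp.
have suppy := finite_support_steps (raises_steps xy) supp.
have yt : steps y t.
  have [w yw hw] := steps_highest suppy.
  have xw := steps_trans (raises_steps xy) yw.
  by rewrite (highest_unique supp xt ht xw hw).
have [le_xy eq_xy] := sumsq_raises supp xy ty.
have le_yt := sumsq_le suppy yt ht.
exists k, y; split=> //; first by split=> //; lia.
have : sumsq M N x == sumsq M N y by lia.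
by rewrite eq_xy => /orP[/eqP|/eqP]; [left | right].
Qed.

Lemma extremal_sorted M N t x i : extremal M N t x ->
  cnt x i.+1 N <= cnt x i N -> pair_tableau i x.
Proof.
move=> ex le_i; have [k [y [xy ty _ k_or]]] := extremal_pair i ex.
have k0 : k = 0 by lia.
by rewrite k0 in xy; rewrite (raises0_inv xy).
Qed.

Lemma extremal_swap M N t x i : extremal M N t x ->
  cnt x i N < cnt x i.+1 N -> exists y,
  [/\ extremal M N t y, column_weight M N y < column_weight M N x,
      (forall j, j != i -> j != i.+1 -> y j = x j),
      cnt y i N = cnt x i.+1 N /\ cnt y i.+1 N = cnt x i N &
      swapped (cnt y i) (cnt y i.+1) (cnt x i.+1)].
Proof.
move=> ex lt_i; have [k [y [xy ty ey k_or]]] := extremal_pair i ex.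
have [supp _ _ _] := ex.
have [eq_l eq_r] := raises_cnt xy supp; have := ty N => ?.
have k_neq0 : k <> 0 by lia.
have eq_k : cnt x i.+1 N = cnt x i N + k by lia.
exists y; split=> //.
- case: k xy eq_l eq_r k_or eq_k k_neq0 => // k xy eq_l eq_r _ eq_k _.
  have lt_iM := raises_inner supp xy.
  rewrite /column_weight !(big_split_adjacent (fun j => j * cnt _ j N) lt_iM).
  have -> : \sum_(j < M | (j != i :> nat) && (j != i.+1 :> nat)) j * cnt y j N
          = \sum_(j < M | (j != i :> nat) && (j != i.+1 :> nat)) j * cnt x j N.
    by apply: eq_bigr => j /andP[ji ji1]; rewrite (cnt_col _ (raises_other xy ji ji1)).
  by nia.
- by move=> j ji ji1; rewrite (raises_other xy ji ji1).
- by split; lia.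
- exact: raises_swapped supp xy ty eq_k.
Qed.

(** The counting functions g j, g (j+1), ..., g r of the column that starts as
    column j of t and is exchanged with one column after the other to its
    right. *)
Definition carried (t : arrangement) (j r : nat) (g : nat -> nat -> nat) : Prop :=
  g j =1 cnt t j /\
  forall h, j <= h -> h < r -> swapped (g h) (cnt t h.+1) (g h.+1).

(** Exchanging columns of equal length returns the right one. *)
Lemma swapped_same M N t h : finite_support M N t -> highest t ->
  cnt t h.+1 N = cnt t h N -> swapped (cnt t h) (cnt t h.+1) (cnt t h.+1).
Proof.
move=> supp ht eqN v; split=> [w _|]; first by rewrite leq_add2l; apply: ht.
exists (maxn v N); first exact: leq_maxl.
by rewrite !(cnt_big _ supp (leq_maxr v N)) eqN.
Qed.

Lemma highest_cnt_le t : highest t -> forall j h v, j <= h -> cnt t h v <= cnt t j v.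
Proof.
move=> ht j h v /subnK <-; elim: (h - j) => // d IHd.
by rewrite addSn (leq_trans (ht _ _)).
Qed.

(** Carrying a column through columns of the same length only replaces it by
    the last of them, so the starting column matters through its length
    alone. *)
Lemma carried_later M N t j j' r g : finite_support M N t -> highest t ->
  j <= j' -> j' <= r -> cnt t j N = cnt t j' N -> carried t j r g -> carried t j' r g.
Proof.
move=> supp ht le_j le_r eqN [g0 gS]; split; last first.
  by move=> h le_h; apply: gS; apply: leq_trans le_h.
suff g_eq d : j + d <= j' -> g (j + d) =1 cnt t (j + d).
  by have := g_eq (j' - j); rewrite subnKC //; apply.
elim: d => [|d IHd] le_d; first by rewrite addn0.
have {}IHd := IHd ltac:(lia).
have sw := gS (j + d) ltac:(lia) ltac:(lia).
have eq_d : cnt t (j + d).+1 N = cnt t (j + d) N.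
  have := @highest_cnt_le _ ht j (j + d) N ltac:(lia).
  have := @highest_cnt_le _ ht (j + d) (j + d).+1 N ltac:(lia).
  have := @highest_cnt_le _ ht (j + d).+1 j' N ltac:(lia).
  lia.
rewrite addnS; apply: swapped_inj sw _.
by apply: swapped_ext (swapped_same supp ht eq_d) => // v; rewrite IHd.
Qed.

Lemma carried_earlier M N t j j' r g : finite_support M N t -> highest t ->
  j <= j' -> cnt t j N = cnt t j' N -> carried t j' r g ->
  carried t j r (fun h => if h < j' then cnt t h else g h).
Proof.
move=> supp ht le_j eqN [g0 gS]; split=> [|h le_h lt_h].
  case: (ltnP j j') => [_ v //|le_j'].
  by have -> : j = j'; [lia | exact: g0].
have eq_h : h < j' -> cnt t h.+1 N = cnt t h N.
  move=> lt_hj'.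
  have := @highest_cnt_le _ ht j h N ltac:(lia).
  have := @highest_cnt_le _ ht h h.+1 N ltac:(lia).
  have := @highest_cnt_le _ ht h.+1 j' N ltac:(lia).
  lia.
case: (ltnP h j') => [lt_hj'|le_j'h]; last first.
  by have -> : (h.+1 < j') = false; [lia | apply: gS].
have sw := swapped_same supp ht (eq_h lt_hj').
case: (ltnP h.+1 j') => // le_j'h.
have eq_j' : j' = h.+1 by lia.
by apply: swapped_ext sw => // v; rewrite -eq_j' g0.
Qed.

(** Column k is moved to the left by complete strings, past every shorter
    column, until all lengths are sorted and t is reached.  Each string is the
    reverse of an exchange. *)
Lemma bubble_left M N t k y : extremal M N t y ->
  (forall h, h.+1 < k -> cnt y h.+1 N <= cnt y h N) ->
  (forall h, k <= h -> cnt y h.+1 N <= cnt y h N) ->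
  (0 < k -> cnt y k.+1 N <= cnt y k.-1 N) ->
  [/\ (exists j, [/\ j <= k, cnt t j N = cnt y k N &
         forall g, carried t j k g -> g k =1 cnt y k]) &
      forall h, k < h -> y h = t h].
Proof.
elim: k y => [|k IHk] y ey sorted_l sorted_r sorted_k.
  have hy : highest y by move=> i; apply: extremal_sorted ey _; apply: sorted_r.
  have [_ yt _ _] := ey; rewrite (steps_from_highest yt hy).
  by split=> //; exists 0; split=> // g [].
case: (leqP (cnt y k.+1 N) (cnt y k N)) => [le_k|lt_k].
  have hy : highest y.
    move=> i; apply: extremal_sorted ey _.
    case: (ltngtP i k) => [lt_ik|lt_ki|->] //; first exact: sorted_l.
    exact: sorted_r.
  have [_ yt _ _] := ey; rewrite (steps_from_highest yt hy).
  by split=> //; exists k.+1; split=> // g [].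
have [y' [ey' _ other [eq_l eq_r] sw]] := extremal_swap ey lt_k.
have eq_other h : h != k -> h != k.+1 -> cnt y' h N = cnt y h N.
  by move=> hk hk1; rewrite (cnt_col _ (other h hk hk1)).
have [|||[j [le_jk eq_j car_j]] eq_t] := IHk y' ey'.
- by move=> h lt_h; rewrite !eq_other ?sorted_l; lia.
- move=> h; rewrite leq_eqVlt => /orP[/eqP<-|lt_h]; first by rewrite eq_l eq_r ltnW.
  rewrite (eq_other h.+1) //; try lia.
  have [->|ne_h] := eqVneq h k.+1; first by rewrite eq_r sorted_k.
  by rewrite eq_other ?sorted_r; lia.
- move=> k_gt0; rewrite eq_r eq_other; try lia.
  by have := sorted_l k.-1; rewrite prednK //; apply; lia.
split; last first.
  move=> h lt_h; rewrite -eq_t ?other //; lia.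
exists j; split; [lia | by rewrite eq_j eq_l |].
move=> g [g0 gS].
have eq_gk : g k =1 cnt y' k by apply: car_j; split=> // h le_h lt_h; apply: gS; lia.
apply: swapped_inj (gS k le_jk (ltnSn k)) _.
by apply: swapped_ext sw => // v; rewrite (cnt_col v (eq_t _ (ltnSn k))).
Qed.

(** Complete strings that avoid the last column sort the other lengths; then
    the last column is moved to its place. *)
Lemma extremal_last_column N t x r j g : extremal r.+1 N t x ->
  j <= r -> cnt t j N = cnt x r N -> carried t j r g -> g r =1 cnt x r.
Proof.
move=> ex le_jr eq_j car_g.
move: {2}(column_weight r.+1 N x) (erefl (column_weight r.+1 N x)) => m.
elim/ltn_ind: m x ex eq_j => m IHm x ex eq_j weight_x.
have [supp xt ht _] := ex; have suppt := finite_support_steps xt supp.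
case: (boolP [exists i : 'I_r, (i.+1 < r) && (cnt x i N < cnt x i.+1 N)]).
  move=> /existsP[i /andP[lt_ir lt_i]].
  have [y [ey lt_weight other _ _]] := extremal_swap ex lt_i.
  have eq_r : y r = x r by apply: other; lia.
  rewrite weight_x in lt_weight.
  move=> v; rewrite -(cnt_col _ eq_r); apply: (IHm _ lt_weight _ ey) => //.
  by rewrite (cnt_col _ eq_r).
move=> /existsPn sorted_x.
have [|||[j' [le_j'r eq_j' car_j']] _] := @bubble_left r.+1 N t r x ex.
- move=> h lt_h; have lt_hr : h < r by lia.
  by have := sorted_x (Ordinal lt_hr); rewrite /= lt_h /= -leqNgt.
- by move=> h le_h; rewrite (cnt_out _ supp).
- by rewrite (cnt_out _ supp).
case: (leqP j j') => [le_j|/ltnW le_j].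
  apply: car_j'; apply: (carried_later suppt ht le_j) => //.
  by rewrite eq_j eq_j'.
have car' := carried_earlier suppt ht le_j (etrans eq_j' (esym eq_j)) car_g.
by move=> v; rewrite -(car_j' _ car') ltnNge le_jr.
Qed.

Lemma perm_map_swap (f g : nat -> nat) M i : i.+1 < M ->
  f i = g i.+1 -> f i.+1 = g i -> (forall l, l != i -> l != i.+1 -> f l = g l) ->
  perm_eq [seq f l | l <- iota 0 M] [seq g l | l <- iota 0 M].
Proof.
move=> lt_iM fi fi1 fg.
have -> : M = i + (2 + (M - i.+2)) by lia.
rewrite (iotaD 0 i) (iotaD _ 2) !map_cat /= add0n fi fi1.
have -> : [seq f l | l <- iota 0 i] = [seq g l | l <- iota 0 i].
  by apply/eq_in_map => l; rewrite mem_iota => lt_l; apply: fg; lia.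
have -> : [seq f l | l <- iota (i + 2) (M - i.+2)] = [seq g l | l <- iota (i + 2) (M - i.+2)].
  by apply/eq_in_map => l; rewrite mem_iota => lt_l; apply: fg; lia.
by rewrite perm_cat2l (perm_catCA [:: g i.+1] [:: g i]).
Qed.

(** Conversely column j of t can be carried to the right end by lowering,
    which permutes the column lengths. *)
Lemma carry_to_last M N t j r : finite_support M N t -> highest t ->
  j <= r -> r < M -> exists x,
  [/\ finite_support M N x, steps x t, cnt x r N = cnt t j N,
      perm_eq [seq cnt x l N | l <- iota 0 M] [seq cnt t l N | l <- iota 0 M] &
      forall g, carried t j r g -> g r =1 cnt x r].
Proof.
move=> supp ht le_jr lt_rM.
suff: exists x,
  [/\ finite_support M N x /\ steps x t, cnt x r N = cnt t j N,
      perm_eq [seq cnt x l N | l <- iota 0 M] [seq cnt t l N | l <- iota 0 M],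
      (forall v, cnt t r v <= cnt x r v) /\ (forall l, r < l -> x l = t l) &
      forall g, carried t j r g -> g r =1 cnt x r].
  by move=> [x [[suppx xt] ? ? _ ?]]; exists x.
rewrite -(subnKC le_jr) in lt_rM *; elim: (r - j) lt_rM => [|d IHd] lt_rM.
  rewrite addn0; exists t; split=> //; first by split=> //; apply: StepsRefl.
  by move=> g [].
have [x [[suppx xt] eq_r perm_x [dom eq_l] car]] := IHd ltac:(lia).
have tx : pair_tableau (j + d) x.
  move=> v; rewrite (cnt_col v (eq_l _ (ltnSn _))).
  by apply: leq_trans (dom v); apply: ht.
have [|y [suppy yx eq_y eq_y1]] := lower_string suppx _ tx; first by lia.
have eqN : cnt y (j + d).+1 N = cnt y (j + d) N + (cnt x (j + d) N - cnt x (j + d).+1 N).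
  by have := tx N; lia.
have sw := raises_swapped suppy yx tx eqN.
have eq_o l : l != j + d -> l != (j + d).+1 -> x l = y l by apply: raises_other yx.
rewrite addnS; exists y; split.
- by split=> //; apply: steps_trans (raises_steps yx) xt.
- by rewrite eq_y1.
- apply: perm_trans perm_x; apply: (@perm_map_swap _ _ _ (j + d)) => //; first lia.
  by move=> l h1 h2; rewrite (cnt_col _ (eq_o l h1 h2)).
- split=> [v|l lt_l]; last by rewrite -eq_o ?eq_l //; lia.
  have [_ [w le_w eq_w]] := sw v; have := tx w; rewrite -(cnt_col v (eq_l _ (ltnSn _))).
  by lia.
move=> g [g0 gS].
apply: swapped_inj (gS (j + d) ltac:(lia) ltac:(lia)) _.
have eq_g : g (j + d) =1 cnt x (j + d).
  by apply: car; split=> // h le_h lt_h; apply: gS; lia.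
by apply: swapped_ext sw => // v; rewrite (cnt_col v (eq_l _ (ltnSn _))).
Qed.

(** * Partitions, column lengths and corners *)

Lemma mem_diagram mu j i : is_partition mu ->
  ((j, i) \in diagram mu) = [&& 0 < j, 0 < i & i <= zeta mu j].
Proof.
move=> mu_part; rewrite inE /=; case: j => //= j; case: i => //= i.
rewrite /part /zeta /=; elim: mu i mu_part => [|m mu IH] i.
  by rewrite nth_nil.
rewrite /is_partition /= => mu_path.
have mu_part := path_sorted mu_path.
case: i => [|i] /=.
  case: leqP => //= lt_m; symmetry; apply/negbTE; rewrite -leqNgt leqn0 addn_eq0 /=.
  rewrite -leqn0 leqNgt -has_count; apply/hasPn => k k_mu.
  have geq_trans : transitive geq by move=> a b c /= ? ?; lia.
  by have /allP/(_ k k_mu) /= := order_path_min geq_trans mu_path; lia.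
rewrite IH //; case: (leqP j.+1 m) => //= lt_m.
have -> : count (leq j.+1) mu = 0; last by lia.
apply/eqP; rewrite -leqn0 leqNgt -has_count; apply/hasPn => k k_mu.
have geq_trans : transitive geq by move=> a b c /= ? ?; lia.
by have /allP/(_ k k_mu) /= := order_path_min geq_trans mu_path; lia.
Qed.

Lemma zeta_anti mu j j' : j <= j' -> zeta mu j' <= zeta mu j.
Proof. by move=> le_j; apply: sub_count => k /= /(leq_trans le_j). Qed.

(** Column j is nonempty if and only if the first row reaches it. *)
Lemma zeta_part mu j : is_partition mu -> 0 < j -> (0 < zeta mu j) = (j <= part mu 1).
Proof.
move=> mu_part j_gt0; have := mem_diagram j 1 mu_part.
by rewrite inE /= j_gt0 /=.
Qed.

Lemma zeta_ext mu z : is_partition mu ->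
  (forall j i, 0 < j -> 0 < i -> ((j, i) \in diagram mu) = (i <= z j)) ->
  forall j, 0 < j -> zeta mu j = z j.
Proof.
move=> mu_part eq_z j j_gt0.
have H i : 0 < i -> (i <= zeta mu j) = (i <= z j).
  by move=> i_gt0; rewrite -eq_z // mem_diagram // j_gt0 i_gt0.
apply/eqP; rewrite eqn_leq; apply/andP; split.
  by case: (posnP (zeta mu j)) => [->|/H <-].
by case: (posnP (z j)) => [->|/H ->].
Qed.

Lemma corner_row mu b : is_partition mu -> corner mu b ->
  [/\ 0 < b.1, 0 < b.2, part mu b.2 = b.1 & zeta mu b.1 = b.2].
Proof.
case: b => j i mu_part /and3P[]; rewrite /right_of /below /= => in_b out_r out_b.
move: (in_b) out_b; rewrite !mem_diagram //= => /and3P[j_gt0 i_gt0 le_i] out_b.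
by move: in_b out_r; rewrite !inE /= => /and3P[_ _ le_j] out_r; split; lia.
Qed.

Lemma part_remove_corner mu b i : is_partition mu -> corner mu b -> 0 < i ->
  part (remove_corner mu b) i = part mu i - (i == b.2).
Proof.
move=> mu_part cb i_gt0; have [b1 b2 eq_part _] := corner_row mu_part cb.
rewrite /part nth_set_nth /=; have -> : (i.-1 == b.2.-1) = (i == b.2) by lia.
by case: eqP => [->|_]; [move: eq_part; rewrite /part => ->; lia | rewrite subn0].
Qed.

Lemma is_partitionP mu :
  reflect (forall i, nth 0 mu i.+1 <= nth 0 mu i) (is_partition mu).
Proof.
apply: (iffP (sortedP 0)) => [mu_part i|mu_part i _]; last exact: mu_part.
by case: (ltnP i.+1 (size mu)) => [/mu_part //|/(nth_default 0)->].
Qed.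

Lemma remove_corner_partition mu b : is_partition mu -> corner mu b ->
  is_partition (remove_corner mu b).
Proof.
move=> mu_part cb; apply/is_partitionP => i.
have [b1 b2 eq_part eq_zeta] := corner_row mu_part cb.
have := part_remove_corner mu_part cb (ltn0Sn i).
have := part_remove_corner mu_part cb (ltn0Sn i.+1); rewrite /part /= => -> ->.
have := is_partitionP _ mu_part i.
case/and3P: cb => _ _; rewrite inE /= b1; move: eq_part; rewrite /part.
have [eq_i|ne_i] := eqVneq i.+1 b.2; have [eq_i1|ne_i1] := eqVneq i.+2 b.2.
- by lia.
- by rewrite -eq_i /=; lia.
- by rewrite -eq_i1 /=; lia.
by rewrite /=; lia.
Qed.

Lemma zeta_remove_corner mu b j : is_partition mu -> corner mu b -> 0 < j ->
  zeta (remove_corner mu b) j = zeta mu j - (j == b.1).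
Proof.
move=> mu_part cb; have [b1 b2 eq_part eq_zeta] := corner_row mu_part cb.
apply: (@zeta_ext _ (fun j => zeta mu j - (j == b.1)) (remove_corner_partition mu_part cb)).
move=> {}j i j_gt0 i_gt0; rewrite inE /= j_gt0 i_gt0 part_remove_corner //=.
have := mem_diagram j i mu_part; rewrite inE /= j_gt0 i_gt0 /=.
have := mem_diagram b.1 i mu_part; rewrite inE /= b1 i_gt0 /=.
by case: (j =P b.1) => [->|]; case: (i =P b.2) => [->|]; lia.
Qed.

(** * Slides are raises *)

Lemma leq_count_sub (s s' : seq nat) (a a' : pred nat) : uniq s ->
  (forall i, i \in s -> a i -> (i \in s') && a' i) -> count a s <= count a' s'.
Proof.
move=> s_uniq sub; rewrite -!size_filter; apply: uniq_leq_size.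
  exact: filter_uniq.
by move=> i; rewrite !mem_filter andbC => /andP[/sub sub_i /sub_i]; rewrite andbC.
Qed.

Lemma leq_count_cover (s : seq nat) (a b c : pred nat) :
  (forall k, a k -> b k || c k) -> count a s <= count b s + count c s.
Proof.
by move=> sub; elim: s => //= k s IHs; have := sub k; lia.
Qed.

Lemma has_eq_count (s : seq nat) (a : pred nat) : uniq s ->
  {in s &, forall i i', a i -> a i' -> i = i'} -> has a s = count a s :> nat.
Proof.
elim: s => //= i s IHs /andP[i_s s_uniq] inj_a.
rewrite -IHs //; last by move=> k k' ks k's; apply: inj_a; rewrite inE ?ks ?k's orbT.
case: (boolP (a i)) => //= ai; case: (boolP (has a s)) => // /hasP[k ks ak].
have := inj_a i k; rewrite !inE eqxx ks orbT => /(_ isT isT ai ak) eq_ik.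
by rewrite eq_ik ks in i_s.
Qed.

Lemma sum_has_eq_count_lt (s : seq nat) (P : pred nat) (f : nat -> nat) v : uniq s ->
  {in s &, forall i i', P i -> P i' -> f i = f i' -> i = i'} ->
  \sum_(u < v) has (fun i => P i && (f i == u)) s = count (fun i => P i && (f i < v)) s.
Proof.
move=> s_uniq inj_f; elim: v => [|v IHv].
  by rewrite big_ord0; symmetry; apply/eqP; rewrite -leqn0 leqNgt -has_count;
     apply/hasPn => i _; rewrite ltn0 andbF.
rewrite big_ord_recr /= IHv has_eq_count //; last first.
  by move=> i i' si si' /andP[Pi /eqP fi] /andP[Pi' /eqP fi']; apply: inj_f => //; rewrite fi.
rewrite -count_predUI [X in _ + X](_ : _ = 0) ?addn0.
  by apply: eq_count => i /=; case: (P i) => //=; rewrite ltnS [RHS]leq_eqVlt orbC.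
apply/eqP; rewrite -leqn0 leqNgt -has_count; apply/hasPn => i _ /=.
by case: eqP => [->|]; rewrite ?ltnn ?andbF.
Qed.

(** A skew diagram is described by the functions lo and hi: its column j has
    the rows lo j + 1, ..., hi j. *)
Definition rows (lo hi : nat -> nat) (j : nat) : seq nat :=
  iota (lo j).+1 (hi j - lo j).

Definition cell (lo hi : nat -> nat) (b : box) : bool :=
  (0 < b.1) && (b.2 \in rows lo hi b.1).

Lemma mem_rows lo hi j i : (i \in rows lo hi j) = (lo j < i <= hi j).
Proof. by rewrite mem_iota; lia. Qed.

(** All pairs of boxes in a row or column are compared, because adjacent pairs
    would lose the comparison across the hole h.  Taking (0, 0), which is no
    box, for h describes a skew tableau without a hole. *)
Definition punctured (lo hi : nat -> nat) (T : filling) (h : box) : Prop :=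
  (forall j i i', cell lo hi (j, i) -> cell lo hi (j, i') ->
     (j, i) != h -> (j, i') != h -> i < i' -> T (j, i) < T (j, i')) /\
  (forall j j' i, cell lo hi (j, i) -> cell lo hi (j', i) ->
     (j, i) != h -> (j', i) != h -> j < j' -> T (j, i) <= T (j', i)).

Definition letters (lo hi : nat -> nat) (T : filling) (h : box) : arrangement :=
  fun j v => has (fun i => ((j.+1, i) != h) && (T (j.+1, i) == v)) (rows lo hi j.+1).

Lemma punctured_inj lo hi T h j i i' : punctured lo hi T h ->
  cell lo hi (j, i) -> cell lo hi (j, i') -> (j, i) != h -> (j, i') != h ->
  T (j, i) = T (j, i') -> i = i'.
Proof.
move=> [col _] ci ci' hi' hi'' eqT; case: (ltngtP i i') => // lt.
  by have := col j i i' ci ci' hi' hi'' lt; lia.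
by have := col j i' i ci' ci hi'' hi' lt; lia.
Qed.

Lemma cnt_letters lo hi T h j v : punctured lo hi T h ->
  cnt (letters lo hi T h) j v
    = count (fun i => ((j.+1, i) != h) && (T (j.+1, i) < v)) (rows lo hi j.+1).
Proof.
move=> pT; rewrite /cnt /letters sum_has_eq_count_lt ?iota_uniq // => i i' si si' hi' hi''.
by apply: (punctured_inj pT).
Qed.

Section Hole.

Variables (lo hi : nat -> nat).
Hypothesis lo_anti : forall j j', j <= j' -> lo j' <= lo j.
Hypothesis hi_anti : forall j j', j <= j' -> hi j' <= hi j.

(** Compare the letters smaller than v in the two columns.  The right column
    can have more of them in the lo (j+1) - lo (j+2) rows above the left one,
    and one more in the row of the hole once v exceeds its entry x there; in all
    other rows its entries are at least those of the left column.  This bound is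
    attained at v = x + 1, so x is the letter to be raised. *)
Lemma raisable_hole T j i :
  let x := T (j.+2, i) in
  punctured lo hi T (j.+1, i) -> cell lo hi (j.+1, i) -> cell lo hi (j.+2, i) ->
  (cell lo hi (j.+1, i.+1) -> x < T (j.+1, i.+1)) ->
  raisable j x (letters lo hi T (j.+1, i)).
Proof.
move=> x pT cA cB lt_x.
have [col row] := pT; move: (cA) (cB).
rewrite /cell /= !mem_rows => /andP[loA hiA] /andP[loB hiB].
have le_lo := lo_anti (leqnSn j.+1); have le_hi := hi_anti (leqnSn j.+1).
pose A v := count (fun k => ((j.+1, k) != (j.+1, i)) && (T (j.+1, k) < v)) (rows lo hi j.+1).
pose B v := count (fun k => ((j.+2, k) != (j.+1, i)) && (T (j.+2, k) < v)) (rows lo hi j.+2).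
have neB k : (j.+2, k) != (j.+1, i) by rewrite xpair_eqE; lia.
have bound v : B v <= A v + (lo j.+1 - lo j.+2) + (x < v).
  have cover := @leq_count_cover (rows lo hi j.+2).
  apply: leq_trans (cover _ (fun k => [&& lo j.+1 < k, k != i & T (j.+2, k) < v])
    (fun k => (k <= lo j.+1) || (k == i) && (x < v)) _) _.
    move=> k /andP[_ lt_T]; rewrite lt_T andbT.
    by have [eq_k|] := eqVneq k i; [move: lt_T; rewrite eq_k -/x => ->|]; lia.
  rewrite -addnA; apply: leq_add; last first.
    apply: leq_trans
      (cover _ (fun k => k <= lo j.+1) (fun k => (k == i) && (x < v)) _) _ => //.
    apply: leq_add; last first.
      case: (x < v); last by rewrite (@eq_count _ _ pred0) ?count_pred0 // => k; rewrite andbF.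
      rewrite (@eq_count _ _ (pred1 i)) => [|k]; last by rewrite andbT.
      by rewrite count_uniq_mem ?iota_uniq //; case: (_ \in _).
    rewrite -[leqRHS](size_iota (lo j.+2).+1) -count_predT.
    apply: leq_count_sub; first exact: iota_uniq.
    by move=> k; rewrite mem_rows mem_iota /=; lia.
  apply: leq_count_sub; first exact: iota_uniq.
  move=> k kB /and3P[lt_k ne_k lt_T]; rewrite xpair_eqE eqxx ne_k /=.
  have kA : k \in rows lo hi j.+1 by move: kB; rewrite !mem_rows; lia.
  rewrite kA /=; apply: leq_ltn_trans lt_T; apply: row => //.
  by rewrite xpair_eqE eqxx ne_k.
have A_x : A x.+1 <= i - (lo j.+1).+1.
  rewrite -(size_iota (lo j.+1).+1 (i - (lo j.+1).+1)) -count_predT.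
  apply: leq_count_sub; first exact: iota_uniq.
  move=> k kA /andP[ne_k lt_T]; rewrite mem_iota andbT.
  move: kA ne_k; rewrite mem_rows xpair_eqE eqxx /= => kA ne_k.
  suff : ~~ (i < k) by lia.
  apply/negP => lt_ik; have cA1 : cell lo hi (j.+1, i.+1) by rewrite /cell mem_rows /=; lia.
  have := lt_x cA1; have [eq_k|ne_k1] := eqVneq k i.+1.
    by move: lt_T; rewrite eq_k ltnS leqNgt => /negbTE->.
  have lt_k1 : i.+1 < k by lia.
  have ck : cell lo hi (j.+1, k) by rewrite /cell mem_rows /= kA.
  have := col j.+1 i.+1 k cA1 ck; rewrite !xpair_eqE eqxx ne_k gtn_eqF //= lt_k1.
  move=> /(_ isT isT isT) lt_T1 /ltn_trans/(_ lt_T1).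
  by move: lt_T; rewrite ltnS leqNgt => /negbTE->.
have B_x : i - lo j.+2 <= B x.+1.
  rewrite -(size_iota (lo j.+2).+1 (i - lo j.+2)) -count_predT.
  apply: leq_count_sub; first exact: iota_uniq.
  move=> k; rewrite mem_iota neB mem_rows /= => k_iota _.
  apply/andP; split; first lia.
  have [->|ne_k] := eqVneq k i; first exact: leqnn.
  rewrite ltnS ltnW //; apply: col; rewrite ?neB ///cell ?mem_rows /=; lia.
have eqA v : cnt (letters lo hi T (j.+1, i)) j v = A v by rewrite cnt_letters.
have eqB v : cnt (letters lo hi T (j.+1, i)) j.+1 v = B v by rewrite cnt_letters.
by split=> u; rewrite !eqA !eqB; have := bound u; [|move=> ? le_u]; lia.
Qed.

Lemma letters_move_right T j i :
  let x := T (j.+2, i) in let T' := [eta T with (j.+1, i) |-> x] in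
  punctured lo hi T (j.+1, i) -> cell lo hi (j.+1, i) -> cell lo hi (j.+2, i) ->
  letters lo hi T' (j.+2, i) = shift_left j x (letters lo hi T (j.+1, i)).
Proof.
move=> x T' pT cA cB.
have neB k : (j.+2, k) != (j.+1, i) by rewrite xpair_eqE; lia.
have neA k : (j.+1, k) != (j.+2, i) by rewrite xpair_eqE; lia.
apply: functional_extensionality => l; apply: functional_extensionality => v.
rewrite /shift_left /letters; have [->|ne_lj] := eqVneq l j.
  apply/hasP/orP.
    move=> [k kA]; rewrite /T' /= neA /=.
    case: ((j.+1, k) =P (j.+1, i)) => [_ /eqP->|/eqP ne_k Tk]; first by right.
    by left; apply/hasP; exists k => //; rewrite Tk ne_k.
  case=> [/hasP[k kA /andP[ne_k Tk]]|/eqP->].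
    by exists k => //; rewrite /T' /= (negbTE ne_k) Tk neA.
  exists i; first by case/andP: cA.
  by rewrite /T' /= eqxx neA eqxx.
have [->|ne_lj1] := eqVneq l j.+1.
  apply/hasP/andP.
    move=> [k kB]; rewrite /T' /= (negbTE (neB k)) => /andP[ne_k Tk]; split.
      by apply/hasP; exists k => //; rewrite neB.
    apply: contra ne_k => /eqP eq_v; move: Tk; rewrite eq_v => /eqP Tk.
    by rewrite (punctured_inj pT _ _ (neB k) (neB i) Tk).
  move=> [/hasP[k kB /andP[_ Tk]] ne_v]; exists k => //.
  rewrite /T' /= (negbTE (neB k)) Tk andbT.
  by apply: contra ne_v => /eqP[eq_k]; rewrite -(eqP Tk) eq_k.
apply: eq_has => k /=; rewrite /T' /= !xpair_eqE !eqSS (negbTE ne_lj) /=.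
by case: eqP => // eq_l; rewrite eq_l eqxx in ne_lj1.
Qed.

Lemma punctured_move_right T j i :
  let T' := [eta T with (j.+1, i) |-> T (j.+2, i)] in
  punctured lo hi T (j.+1, i) -> cell lo hi (j.+1, i) -> cell lo hi (j.+2, i) ->
  (cell lo hi (j.+1, i.+1) -> T (j.+2, i) < T (j.+1, i.+1)) ->
  punctured lo hi T' (j.+2, i).
Proof.
move=> T' pT cA cB lt_x; have [col row] := pT.
have neB k : (j.+2, k) != (j.+1, i) by rewrite xpair_eqE; lia.
have le_lo := lo_anti (leqnSn j.+1); have le_hi := hi_anti (leqnSn j.+1).
split=> [l k k' ck ck' nk nk' lt_k|l l' k cl cl' nl nl' lt_l]; rewrite /T' /=.
- case: eqP => [[eq_l eq_k]|/eqP ne_k]; case: eqP => [[eq_l' eq_k']|/eqP ne_k'].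
  + by lia.
  + subst l k; have cA1 : cell lo hi (j.+1, i.+1).
      by move: cA ck'; rewrite /cell !mem_rows /=; lia.
    have [->|ne] := eqVneq k' i.+1; first exact: lt_x.
    apply: ltn_trans (lt_x cA1) _; apply: col => //; first by rewrite xpair_eqE; lia.
    by lia.
  + subst l k'; have cB1 : cell lo hi (j.+2, k).
      by move: cB ck; rewrite /cell !mem_rows /=; lia.
    apply: leq_ltn_trans (row j.+1 j.+2 k ck cB1 ne_k (neB k) _) _ => //.
    by apply: col; rewrite ?neB.
  + exact: col.
case: eqP => [[eq_l eq_k]|/eqP ne_k]; case: eqP => [[eq_l' eq_k']|/eqP ne_k'].
- by lia.
- subst l k; have : l' != j.+2 by move: nl'; rewrite xpair_eqE; lia.
  by move=> ne_l'; apply: row; rewrite ?neB //; lia.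
- subst l' k; apply: row; rewrite ?neB //; lia.
- exact: row.
Qed.

Lemma letters_move_down T j i :
  let T' := [eta T with (j, i) |-> T (j, i.+1)] in
  cell lo hi (j, i) -> cell lo hi (j, i.+1) ->
  letters lo hi T' (j, i.+1) = letters lo hi T (j, i).
Proof.
move=> T' ci ci1; apply: functional_extensionality => l.
apply: functional_extensionality => v; rewrite /letters.
have [eq_l|ne_l] := eqVneq l.+1 j; last first.
  by apply: eq_has => k /=; rewrite /T' /= !xpair_eqE (negbTE ne_l).
subst j; apply/hasP/hasP => -[k krow]; rewrite /T' /= !xpair_eqE eqxx /=.
  case: (k =P i) => [->|/eqP ne_k] /andP[ne_k1 Tk].
    exists i.+1; first by case/andP: ci1.
    by rewrite xpair_eqE Tk; lia.
  by exists k => //; rewrite xpair_eqE eqxx Tk /= ne_k.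
move=> /andP[ne_k Tk]; case: (k =P i.+1) => [eq_k|/eqP ne_k1].
  exists i; first by case/andP: ci.
  by rewrite /= !xpair_eqE !eqxx -eq_k Tk /=; lia.
by exists k => //; rewrite /= !xpair_eqE eqxx (negbTE ne_k) ne_k1 Tk.
Qed.

Lemma punctured_move_down T j i :
  let T' := [eta T with (j, i) |-> T (j, i.+1)] in
  punctured lo hi T (j, i) -> cell lo hi (j, i) -> cell lo hi (j, i.+1) ->
  (cell lo hi (j.+1, i) -> T (j, i.+1) <= T (j.+1, i)) ->
  punctured lo hi T' (j, i.+1).
Proof.
move=> T' pT ci ci1 le_x; have [col row] := pT.
have ne1 : (j, i.+1) != (j, i) by rewrite xpair_eqE; lia.
split=> [l k k' ck ck' nk nk' lt_k|l l' k cl cl' nl nl' lt_l]; rewrite /T' /=.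
- case: eqP => [[eq_l eq_k]|/eqP ne_k]; case: eqP => [[eq_l' eq_k']|/eqP ne_k'].
  + by lia.
  + subst l k; have : k' != i.+1 by move: nk'; rewrite xpair_eqE; lia.
    by move=> ne; apply: col => //; lia.
  + by subst l k'; apply: col => //; lia.
  + exact: col.
case: eqP => [[eq_l eq_k]|/eqP ne_k]; case: eqP => [[eq_l' eq_k']|/eqP ne_k'].
- by lia.
- subst l k; have c1 : cell lo hi (j.+1, i).
    move: ci cl'; rewrite /cell !mem_rows /= => ci cl'.
    by have := lo_anti (leqnSn j); have := hi_anti lt_l; lia.
  have [->|ne] := eqVneq l' j.+1; first exact: le_x.
  apply: leq_trans (le_x c1) _; apply: row => //; first by rewrite xpair_eqE; lia.
  by lia.
- subst l' k; have c1 : cell lo hi (l, i.+1).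
    move: cl ci1; rewrite /cell !mem_rows /= => cl ci1.
    by have := hi_anti (ltnW lt_l); lia.
  apply: leq_trans (ltnW (col l i i.+1 cl c1 ne_k _ _)) _ => //.
    by rewrite xpair_eqE; lia.
  by apply: row => //; rewrite xpair_eqE; lia.
- exact: row.
Qed.

End Hole.

(** * Rectification *)

Lemma cell_diagram mu lo j i : is_partition mu -> cell lo (zeta mu) (j, i) ->
  (j, i) \in diagram mu.
Proof. by move=> mu_part; rewrite /cell mem_rows mem_diagram //=; lia. Qed.

Lemma move_hole_steps n mu lo T b T' b' : is_partition mu ->
  (forall j j', j <= j' -> lo j' <= lo j) ->
  move_hole mu T b T' b' ->
  cell lo (zeta mu) b -> punctured lo (zeta mu) T b ->
  (forall c, cell lo (zeta mu) c -> c != b -> 1 <= T c <= n) ->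
  [/\ cell lo (zeta mu) b' && corner mu b', punctured lo (zeta mu) T' b',
      (forall c, cell lo (zeta mu) c -> c != b' -> 1 <= T' c <= n) &
      steps (letters lo (zeta mu) T b) (letters lo (zeta mu) T' b')].
Proof.
move=> mu_part lo_anti; have hi_anti := fun j j' => @zeta_anti mu j j'.
have cell_r j i : cell lo (zeta mu) (j, i) -> (j.+1, i) \in diagram mu ->
    cell lo (zeta mu) (j.+1, i).
  rewrite /cell !mem_rows mem_diagram //=; have := lo_anti _ _ (leqnSn j); lia.
have cell_d j i : cell lo (zeta mu) (j, i) -> (j, i.+1) \in diagram mu ->
    cell lo (zeta mu) (j, i.+1).
  rewrite /cell !mem_rows mem_diagram //=; lia.
elim=> [{}T {}b nr nb cb pT bT|{}T [j i] {}T' {}b' in_r lt_d _ IH cb pT bT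
       |{}T [j i] {}T' {}b' in_d le_r _ IH cb pT bT].
- split=> //; last exact: StepsRefl.
  by rewrite cb /corner nr nb; case: b cb {nr nb pT bT} => j i /cell_diagram->.
- rewrite /right_of /below /= in in_r lt_d IH *.
  case: j => [|j] in cb pT bT in_r lt_d IH *; first by move: cb; rewrite /cell.
  have cr := cell_r _ _ cb in_r.
  have lt_d' : cell lo (zeta mu) (j.+1, i.+1) -> T (j.+2, i) < T (j.+1, i.+1).
    by move=> /cell_diagram-/(_ mu_part)/lt_d.
  have pT' := punctured_move_right lo_anti hi_anti pT cb cr lt_d'.
  have [|cb' pT'' bT'' st] := IH cr pT'.
    move=> c cc ne_c /=; case: eqP => [_|/eqP ne_cb]; last exact: bT.
    by apply: bT => //; rewrite xpair_eqE; lia.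
  split=> //; apply: StepsRaise (raisable_hole lo_anti hi_anti pT cb cr lt_d') _.
  by rewrite -letters_move_right.
rewrite /right_of /below /= in in_d le_r IH *.
have cd := cell_d _ _ cb in_d.
have le_r' : cell lo (zeta mu) (j.+1, i) -> T (j, i.+1) <= T (j.+1, i).
  by move=> /cell_diagram-/(_ mu_part)/le_r.
have pT' := punctured_move_down lo_anti hi_anti pT cb cd le_r'.
have [|cb' pT'' bT'' st] := IH cd pT'.
  move=> c cc ne_c /=; case: eqP => [_|/eqP ne_cb]; last exact: bT.
  by apply: bT => //; rewrite xpair_eqE; lia.
by split=> //; rewrite -letters_move_down.
Qed.

(** The letters of a skew tableau, column by column. *)
Definition contents (S : skew) : arrangement :=
  letters (zeta (inner S)) (zeta (outer S)) (entry S) (0, 0).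

Lemma mem_skew S b : is_partition (outer S) -> is_partition (inner S) ->
  (b \in skew_diagram S) = cell (zeta (inner S)) (zeta (outer S)) b.
Proof.
case: b => j i out_part inn_part; rewrite inE !mem_diagram // /cell mem_rows /=; lia.
Qed.

Lemma cell_neq_origin lo hi j i : cell lo hi (j, i) -> (j, i) != (0, 0).
Proof. by rewrite /cell xpair_eqE /=; lia. Qed.

Lemma punctured_skew n S : skew_tableau n S ->
  punctured (zeta (inner S)) (zeta (outer S)) (entry S) (0, 0).
Proof.
case=> out_part inn_part sub [_ row col].
have mem b := mem_skew b out_part inn_part.
split=> [j i i' ci ci' _ _|j j' i cj cj' _ _].
  move=> lt_i; rewrite -(subnKC lt_i) in ci' *; elim: (i' - i.+1) ci' => [|d IHd] ci'.
    by rewrite addn0 in ci' *; apply: (col (j, i)); rewrite mem.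
  have ci'' : cell (zeta (inner S)) (zeta (outer S)) (j, i.+1 + d).
    by move: ci ci'; rewrite /cell !mem_rows /=; lia.
  apply: ltn_trans (IHd ci'') _; rewrite addnS in ci' *.
  by apply: (col (j, i.+1 + d)); rewrite mem.
move=> lt_j; rewrite -(subnKC lt_j) in cj' *; elim: (j' - j.+1) cj' => [|d IHd] cj'.
  by rewrite addn0 in cj' *; apply: (row (j, i)); rewrite mem.
have cj'' : cell (zeta (inner S)) (zeta (outer S)) (j.+1 + d, i).
  move: cj cj'; rewrite /cell !mem_rows /=.
  have := @zeta_anti (outer S) (j.+1 + d) (j.+1 + d.+1) ltac:(lia).
  by have := @zeta_anti (inner S) j (j.+1 + d) ltac:(lia); lia.
apply: leq_trans (IHd cj'') _; rewrite addnS in cj' *.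
by apply: (row (j.+1 + d, i)); rewrite mem.
Qed.

Lemma letters_ext lo hi lo' hi' T h h' :
  (forall j i, cell lo hi (j, i) && ((j, i) != h) = cell lo' hi' (j, i) && ((j, i) != h')) ->
  letters lo hi T h = letters lo' hi' T h'.
Proof.
move=> eq_cell; apply: functional_extensionality => j.
apply: functional_extensionality => v; rewrite /letters.
have H i := eq_cell j.+1 i; rewrite /cell /= in H.
apply/hasP/hasP => -[i i_row /andP[ne_i Ti]]; have := H i; rewrite i_row ne_i /=.
  by move=> /esym/andP[? ne]; exists i => //; rewrite Ti andbT.
by move=> /andP[? ne]; exists i => //; rewrite Ti andbT.
Qed.

Lemma punctured_ext lo hi lo' hi' T h h' :
  (forall j i, cell lo hi (j, i) && ((j, i) != h) = cell lo' hi' (j, i) && ((j, i) != h')) ->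
  punctured lo hi T h -> punctured lo' hi' T h'.
Proof.
move=> eq_cell [col row]; split=> [j i i' c c' n n'|j j' i c c' n n'].
  have := eq_cell j i; have := eq_cell j i'; rewrite c c' n n' => /andP[? ?] /andP[? ?].
  exact: col.
have := eq_cell j i; have := eq_cell j' i; rewrite c c' n n' => /andP[? ?] /andP[? ?].
exact: row.
Qed.

Lemma slide_steps n S S' : skew_tableau n S -> slide S S' ->
  skew_tableau n S' /\ steps (contents S) (contents S').
Proof.
move=> sk [c [b [c_corner mh eq_in eq_out]]].
have pS := punctured_skew sk; have [out_part inn_part sub [bnd _ _]] := sk.
have inn_part' := remove_corner_partition inn_part c_corner.
have [c1 c2 part_c zeta_c] := corner_row inn_part c_corner.
have zeta_inn j : 0 < j -> zeta (inner S') j = zeta (inner S) j - (j == c.1).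
  by move=> j_gt0; rewrite eq_in zeta_remove_corner.
have c_out : c.2 <= zeta (outer S) c.1.
  have /sub : c \in diagram (inner S) by case/and3P: c_corner.
  by rewrite (surjective_pairing c) mem_diagram //= => /and3P[].
have eq_cell j i : cell (zeta (inner S)) (zeta (outer S)) (j, i) && ((j, i) != (0, 0))
    = cell (zeta (inner S')) (zeta (outer S)) (j, i) && ((j, i) != c).
  rewrite /cell /= !mem_rows (surjective_pairing c) !xpair_eqE.
  case: (posnP j) => //= j_gt0; rewrite zeta_inn //.
  by case: (j =P c.1) => [->|]; lia.
have cell_c : cell (zeta (inner S')) (zeta (outer S)) c.
  by rewrite /cell mem_rows c1 zeta_inn // eqxx; lia.
have bnd' d : cell (zeta (inner S')) (zeta (outer S)) d -> d != c -> 1 <= entry S d <= n.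
  case: d => j i cd ne_d; apply: bnd; rewrite mem_skew //.
  by have := eq_cell j i; rewrite cd ne_d => /andP[].
have lo_anti j j' : j <= j' -> zeta (inner S') j' <= zeta (inner S') j by apply: zeta_anti.
have pc := punctured_ext eq_cell pS.
have [/andP[cell_b corner_b] pb bnd_b st] :=
  move_hole_steps out_part lo_anti mh cell_c pc bnd'.
have out_part' := remove_corner_partition out_part corner_b.
have [b1 b2 part_b zeta_b] := corner_row out_part corner_b.
have zeta_out j : 0 < j -> zeta (outer S') j = zeta (outer S) j - (j == b.1).
  by move=> j_gt0; rewrite eq_out zeta_remove_corner.
have eq_cell' j i : cell (zeta (inner S')) (zeta (outer S)) (j, i) && ((j, i) != b)
    = cell (zeta (inner S')) (zeta (outer S')) (j, i) && ((j, i) != (0, 0)).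
  rewrite /cell /= !mem_rows (surjective_pairing b) !xpair_eqE.
  case: (posnP j) => //= j_gt0; rewrite zeta_out //.
  by case: (j =P b.1) => [->|]; lia.
have [colS' rowS'] := punctured_ext eq_cell' pb.
split; last first.
  by rewrite /contents (letters_ext _ eq_cell) -(letters_ext _ eq_cell').
rewrite -eq_in in inn_part'; rewrite -eq_out in out_part'.
split=> //.
  case=> j i; rewrite !mem_diagram // => /and3P[j_gt0 i_gt0 le_i].
  rewrite j_gt0 i_gt0 /= zeta_out //; move: le_i cell_b.
  rewrite zeta_inn // /cell mem_rows => le_i /and3P[_ lt_b _].
  have : (j, i) \in diagram (inner S) by rewrite mem_diagram //; lia.
  move=> /sub; rewrite mem_diagram //.
  case: (j =P b.1) => [eq_j|]; last by lia.
  by subst j; rewrite zeta_inn // in lt_b; lia.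
split=> -[j i]; rewrite !mem_skew // => cd.
- have := eq_cell' j i; rewrite cd (cell_neq_origin cd) => /andP[cd' ne_b]; exact: bnd_b.
- by move=> cd'; apply: rowS'; rewrite ?(cell_neq_origin cd) ?(cell_neq_origin cd').
- by move=> cd'; apply: colS'; rewrite ?(cell_neq_origin cd) ?(cell_neq_origin cd').
Qed.

Lemma rectification_steps n S S' : rectification S S' -> skew_tableau n S ->
  skew_tableau n S' /\ steps (contents S) (contents S').
Proof.
elim=> [{}S _ sk|{}S S1 S2 sl _ IH sk]; first by split=> //; apply: StepsRefl.
have [sk1 st1] := slide_steps sk sl; have [sk2 st2] := IH sk1.
by split=> //; apply: steps_trans st1 st2.
Qed.

Lemma move_hole_total mu T b : is_partition mu -> b \in diagram mu ->
  exists T' b', move_hole mu T b T' b'.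
Proof.
move=> mu_part; case: b => j i.
have bounded k l : (k, l) \in diagram mu -> k + l <= part mu 1 + zeta mu 1.
  rewrite mem_diagram // => /and3P[k_gt0 l_gt0 le_l].
  have := @zeta_anti mu 1 k k_gt0; have := zeta_part mu_part k_gt0; lia.
move: {2}(part mu 1 + zeta mu 1 - (j + i)) (leqnn (part mu 1 + zeta mu 1 - (j + i))) => m.
elim: m j i T => [|m IHm] j i T le_m in_b.
  exists T, (j, i); apply: MoveStop; apply/negP => /bounded /=; lia.
have move_right : (j.+1, i) \in diagram mu -> exists T' b',
    move_hole mu [eta T with (j, i) |-> T (j.+1, i)] (j.+1, i) T' b'.
  by move=> in_r; apply: IHm => //; have := bounded _ _ in_r; lia.
have move_down : (j, i.+1) \in diagram mu -> exists T' b',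
    move_hole mu [eta T with (j, i) |-> T (j, i.+1)] (j, i.+1) T' b'.
  by move=> in_r; apply: IHm => //; have := bounded _ _ in_r; lia.
case: (boolP ((j.+1, i) \in diagram mu)) => in_r;
  case: (boolP ((j, i.+1) \in diagram mu)) => in_d.
- case: (leqP (T (j, i.+1)) (T (j.+1, i))) => [le_T|lt_T].
    by have [T' [b' mh]] := move_down in_d; exists T', b'; apply: MoveDown.
  by have [T' [b' mh]] := move_right in_r; exists T', b'; apply: MoveRight.
- have [T' [b' mh]] := move_right in_r; exists T', b'; apply: MoveRight => //.
  by rewrite /below /= (negbTE in_d).
- have [T' [b' mh]] := move_down in_d; exists T', b'; apply: MoveDown => //.
  by rewrite /right_of /= (negbTE in_r).
- by exists T, (j, i); apply: MoveStop.
Qed.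

Lemma last_corner mu : is_partition mu -> 0 < zeta mu 1 ->
  corner mu (part mu (zeta mu 1), zeta mu 1).
Proof.
move=> mu_part z_gt0; set i := zeta mu 1; set j := part mu i.
have : (1, i) \in diagram mu by rewrite mem_diagram //= leqnn andbT.
rewrite inE /= => /andP[_ j_gt0].
have in_j : (j, i) \in diagram mu by rewrite inE /= leqnn j_gt0 andbT.
rewrite /corner in_j /right_of /below /= !mem_diagram //= negb_and negb_and.
have := @zeta_anti mu 1 j j_gt0; have := zeta_anti mu (leqnSn j).
have : (j.+1, i) \notin diagram mu by rewrite inE /= ltnn !andbF.
by rewrite mem_diagram //= z_gt0 -/i; lia.
Qed.

Lemma rectification_total n S : skew_tableau n S -> exists S', rectification S S'.
Proof.
move: {2}(sumn (inner S)) (erefl (sumn (inner S))) => m.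
elim/ltn_ind: m S => m IHm S sum_m sk; have [out_part inn_part sub _] := sk.
case: (posnP (zeta (inner S) 1)) => [z0|z_gt0].
  exists S; apply: RectDone => -[j i]; apply/negP.
  move=> /corner_row-/(_ inn_part)[/= j_gt0 i_gt0 _].
  by have := zeta_anti (inner S) j_gt0; lia.
have c_corner := last_corner inn_part z_gt0.
move: (_, _) c_corner => c c_corner.
have c_in : c \in diagram (inner S) by case/and3P: c_corner.
have [T' [b' mh]] := move_hole_total (entry S) out_part (sub _ c_in).
pose S1 := Skew (remove_corner (outer S) b') (remove_corner (inner S) c) T'.
have sl : slide S S1 by exists c, b'.
have [sk1 _] := slide_steps sk sl.
have [|S2 rS2] := IHm _ _ S1 erefl sk1; last by exists S2; apply: RectSlide sl rS2.
rewrite -sum_m /= /remove_corner sumn_set_nth0.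
have [c1 _ part_c _] := corner_row inn_part c_corner.
have : nth 0 (inner S) c.2.-1 <= sumn (inner S).
  elim: (inner S) (c.2.-1) => [|m0 s IHs] [|k] //=; first exact: leq_addr.
  by apply: leq_trans (IHs k) _; apply: leq_addl.
by move: part_c; rewrite /part; lia.
Qed.

(** * Columns of skew tableaux *)

Lemma mem_contents S j v : contents S j v = (v \in column S j.+1).
Proof.
rewrite /contents /letters /column; apply/hasP/mapP => -[i i_row].
  by move=> /andP[_ /eqP<-]; exists i.
by move=> ->; exists i => //; rewrite eqxx.
Qed.

Lemma size_column S j : size (column S j) = zeta (outer S) j - zeta (inner S) j.
Proof. by rewrite size_map size_iota. Qed.

Lemma column_sorted n S j : skew_tableau n S -> sorted ltn (column S j.+1).
Proof.
move=> sk; have [col _] := punctured_skew sk.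
apply: (@homo_sorted_in _ _
  (fun i => i \in rows (zeta (inner S)) (zeta (outer S)) j.+1) _ ltn).
- by move=> i i' ci ci' lt_i; apply: col.
- by apply/allP.
- exact: iota_ltn_sorted.
Qed.

Lemma column_eq n S S' j j' : skew_tableau n S -> skew_tableau n S' ->
  contents S j = contents S' j' -> column S j.+1 = column S' j'.+1.
Proof.
move=> sk sk' eq_j.
apply: (irr_sorted_eq ltn_trans ltnn (column_sorted j sk) (column_sorted j' sk')) => v.
by rewrite -!mem_contents eq_j.
Qed.

Lemma column_mem_bound n S j v : skew_tableau n S -> v \in column S j.+1 -> 1 <= v <= n.
Proof.
case=> out_part inn_part _ [bnd _ _] /mapP[i i_row ->]; apply: bnd.
by rewrite mem_skew.
Qed.

Lemma column_out S j : is_partition (outer S) -> part (outer S) 1 < j -> column S j = [::].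
Proof.
move=> out_part lt_j; apply: size0nil; rewrite size_column.
by have := @zeta_part (outer S) j out_part; lia.
Qed.

Lemma finite_support_contents n S M : skew_tableau n S -> part (outer S) 1 <= M ->
  finite_support M n.+1 (contents S).
Proof.
move=> sk le_M j v; rewrite mem_contents => v_col.
have [out_part _ _ _] := sk.
split; last by have := column_mem_bound sk v_col; lia.
by rewrite ltnNge; apply/negP => le_j; move: v_col; rewrite column_out //; lia.
Qed.

Lemma cnt_contents n S j v : skew_tableau n S ->
  cnt (contents S) j v = count (fun a => a < v) (column S j.+1).
Proof.
move=> sk; rewrite cnt_letters; last exact: punctured_skew sk.
by rewrite /column count_map; apply: eq_count => i.
Qed.

Lemma size_column_cnt n S j : skew_tableau n S ->
  cnt (contents S) j n.+1 = size (column S j.+1).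
Proof.
move=> sk; rewrite (cnt_contents j n.+1 sk); apply/eqP; rewrite -all_count.
by apply/allP => v /(column_mem_bound sk); lia.
Qed.

Lemma columnsE S M : is_partition (outer S) -> part (outer S) 1 <= M ->
  columns S = [seq c <- [seq column S j | j <- iota 1 M] | 0 < size c].
Proof.
move=> out_part /subnKC <-; rewrite iotaD map_cat filter_cat -[LHS]cats0.
congr (_ ++ _); symmetry; apply/eqP; rewrite -size_eq0 size_filter -leqn0 leqNgt.
rewrite -has_count; apply/hasPn => c /mapP[j]; rewrite mem_iota => lt_j ->.
by rewrite column_out //; lia.
Qed.

(** * Straight tableaux and frank skew tableaux *)

Lemma highest_straight n S : skew_tableau n S -> zeta (inner S) 1 = 0 ->
  highest (contents S).
Proof.
move=> sk inn0 j v; have [_ row] := punctured_skew sk.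
rewrite !cnt_letters; try exact: punctured_skew sk.
apply: leq_count_sub; first exact: iota_uniq.
move=> i i_row /= lt_v.
have inn0' k : zeta (inner S) k.+1 = 0.
  by have := @zeta_anti (inner S) 1 k.+1 isT; lia.
have i_row' : i \in rows (zeta (inner S)) (zeta (outer S)) j.+1.
  move: i_row; rewrite !mem_rows !inn0'.
  by have := zeta_anti (outer S) (leqnSn j.+1); lia.
rewrite i_row' /=; apply: leq_ltn_trans lt_v; apply: row => //.
Qed.

(** Without inside corners the inner partition is empty, although it may have
    trailing zeros. *)
Lemma rectification_inner S S' : rectification S S' ->
  is_partition (inner S') -> zeta (inner S') 1 = 0.
Proof.
elim=> // {}S no_corner inn_part; case: (posnP (zeta (inner S) 1)) => // z_gt0.
by have := no_corner (part (inner S) (zeta (inner S) 1), zeta (inner S) 1);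
   rewrite last_corner.
Qed.

Lemma straight_columns S : is_partition (outer S) -> zeta (inner S) 1 = 0 ->
  columns S = [seq column S j | j <- iota 1 (part (outer S) 1)].
Proof.
move=> out_part inn0; apply/all_filterP/allP => c /mapP[j].
rewrite mem_iota add1n ltnS => /andP[j_gt0 le_j] ->.
rewrite size_column; have := zeta_part out_part j_gt0.
have := zeta_anti (inner S) j_gt0; lia.
Qed.

(** In a straight shape the empty columns come last, so that the list of
    nonempty columns determines them all. *)
Lemma straight_contents_eq S S' : is_partition (outer S) -> is_partition (outer S') ->
  zeta (inner S) 1 = 0 -> zeta (inner S') 1 = 0 ->
  columns S = columns S' -> contents S = contents S'.
Proof.
move=> out_part out_part' inn0 inn0'; rewrite !straight_columns // => eq_cols.
have eq_part : part (outer S) 1 = part (outer S') 1.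
  by have := congr1 size eq_cols; rewrite !size_map !size_iota.
apply: functional_extensionality => j; apply: functional_extensionality => v.
rewrite !mem_contents; case: (ltnP j (part (outer S) 1)) => [lt_j|le_j]; last first.
  by rewrite !column_out // -?eq_part.
have := congr1 (fun s => nth [::] s j) eq_cols.
rewrite !(nth_map 0) ?size_iota -?eq_part // !nth_iota -?eq_part // add1n.
by move=> ->.
Qed.

Lemma contents_columns_eq n S S' : skew_tableau n S -> skew_tableau n S' ->
  contents S = contents S' -> columns S = columns S'.
Proof.
move=> sk sk' eq_c; have [out_part _ _ _] := sk; have [out_part' _ _ _] := sk'.
rewrite (columnsE out_part (leq_maxl _ (part (outer S') 1))).
rewrite (columnsE out_part' (leq_maxr (part (outer S) 1) _)).
congr filter; apply/eq_in_map => j; rewrite mem_iota => /andP[j_gt0 _].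
by case: j j_gt0 => // j _; apply: column_eq sk sk' _; rewrite eq_c.
Qed.

Lemma straight_skew n lam T : is_partition lam -> semistandard n (diagram lam) T ->
  skew_tableau n (straight lam T).
Proof.
move=> lam_part [bnd row col].
have mem b : (b \in skew_diagram (straight lam T)) = (b \in diagram lam).
  case: b => j i; rewrite inE /= !mem_diagram //= /zeta /=.
  by case: (0 < j) => //=; case: i => //= i; rewrite andbT.
split=> //=.
  by case=> j i; rewrite mem_diagram //= /zeta /=; case: i => [|i]; rewrite ?andbF.
by split=> b; rewrite !mem; [exact: bnd | exact: row | exact: col].
Qed.

Section Rectify.

Variables (n : nat) (lam : seq nat) (T : filling).
Hypotheses (lam_part : is_partition lam) (T_sst : semistandard n (diagram lam) T).

Local Notation t := (contents (straight lam T)).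
Local Notation skT := (straight_skew lam_part T_sst).

Lemma highest_tableau : highest t.
Proof. exact: highest_straight skT _. Qed.

Lemma rectification_contents S S' : skew_tableau n S -> steps (contents S) t ->
  rectification S S' -> columns S' = columns (straight lam T).
Proof.
move=> sk st rect; have [sk' st'] := rectification_steps rect sk.
have [_ inn_part' _ _] := sk'; have inn0 := rectification_inner rect inn_part'.
apply: (contents_columns_eq sk' skT).
have supp := finite_support_contents sk (leqnn _).
exact: highest_unique supp st' (highest_straight sk' inn0) st highest_tableau.
Qed.

Lemma rectifies_toP S : skew_tableau n S ->
  rectifies_to S lam T <-> steps (contents S) t.
Proof.
move=> sk; split=> [[S' rect eq_cols]|st].
  have [sk' st'] := rectification_steps rect sk.
  have [out_part' inn_part' _ _] := sk'.
  have inn0 := rectification_inner rect inn_part'.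
  by rewrite -(straight_contents_eq out_part' _ inn0 _ eq_cols).
have [S' rect] := rectification_total sk.
by exists S' => //; apply: rectification_contents sk st rect.
Qed.

Lemma sumsq_columns S M : skew_tableau n S -> part (outer S) 1 <= M ->
  sumsq M n.+1 (contents S) = \sum_(k <- column_lengths S) k ^ 2.
Proof.
move=> sk le_M; have [out_part _ _ _] := sk.
rewrite /column_lengths (columnsE out_part le_M) big_map big_filter big_map.
rewrite big_mkcond /= /sumsq -(big_mkord predT (fun j => cnt (contents S) j n.+1 ^ 2)).
rewrite -[iota 1 M]/(iota (1 + 0) M) iotaDl big_map /index_iota subn0.
apply: eq_bigr => j _; rewrite add1n size_column_cnt //.
by case: (size _).
Qed.

(** The column lengths are taken up to order and without zeros, both of which
    are irrelevant to the sum of their squares. *)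
Lemma frank_extremal S M : skew_tableau n S -> frank S -> rectifies_to S lam T ->
  finite_support M n.+1 (contents S) ->
  extremal M n.+1 t (contents S).
Proof.
move=> sk [S' rect perm_len] /(rectifies_toP sk) st supp.
split=> //; first exact: highest_tableau.
have eq_cols := rectification_contents sk st rect.
have supp' := finite_support_steps st supp.
have sumsq_M x K : finite_support M n.+1 x -> finite_support K n.+1 x ->
    sumsq M n.+1 x = sumsq K n.+1 x.
  move=> suppM suppK.
  wlog le_MK : M K suppM suppK {supp supp'} / M <= K => [wlog_MK|].
    by case: (leqP M K) => [|/ltnW] le; [|symmetry]; apply: wlog_MK.
  rewrite /sumsq -!(big_mkord predT (fun j => cnt x j n.+1 ^ 2)).
  rewrite (big_cat_nat (leq0n M) le_MK) //=.
  rewrite [X in _ = _ + X]big_nat_cond [X in _ = _ + X]big1 ?addn0 //.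
  move=> j /andP[/andP[le_j _] _].
  by rewrite (cnt_out _ suppM).
pose K := maxn (part (outer S) 1) (part lam 1).
rewrite !(sumsq_M _ K) //; last 2 first.
- by apply: finite_support_contents skT _; apply: leq_maxr.
- by apply: finite_support_contents sk _; apply: leq_maxl.
rewrite (sumsq_columns skT (leq_maxr _ _)) (sumsq_columns sk (leq_maxl _ _)).
apply: perm_big; apply: perm_trans perm_len _.
by rewrite /column_lengths eq_cols.
Qed.

End Rectify.

Lemma rightmost_columnP S : is_partition (outer S) -> 0 < size (rightmost_column S) ->
  exists r, rightmost_column S = column S r.+1 /\ forall j, r < j -> column S j.+1 = [::].
Proof.
move=> out_part; rewrite /rightmost_column (columnsE out_part (leqnn _)).
have: forall j, part (outer S) 1 <= j -> column S j.+1 = [::].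
  by move=> j le_j; apply: column_out.
elim: (part (outer S) 1) => // m IHm out_m.
have -> : iota 1 m.+1 = iota 1 m ++ [:: m.+1] by rewrite -[m.+1 in LHS]addn1 iotaD /= add1n.
rewrite map_cat filter_cat /=.
case: (posnP (size (column S m.+1))) => [/size0nil col_m|col_m]; last first.
  by rewrite last_cat /= => _; exists m.
rewrite cats0; apply: IHm => j; rewrite leq_eqVlt => /orP[/eqP<-//|].
exact: out_m.
Qed.

(** * Disconnected skew tableaux *)

(** In the list ds the rightmost column comes first.  Every row of the
    disconnected diagram consists of a single box, and the rows of the column d
    that is followed by k others in ds have their box in column k + 1. *)
Fixpoint staircase_rows (ds : seq (seq nat)) : seq nat :=
  if ds is d :: ds' then nseq (size d) (size ds) ++ staircase_rows ds' else [::].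

Definition staircase (cs : seq (seq nat)) : skew :=
  Skew (staircase_rows (rev cs)) (map predn (staircase_rows (rev cs)))
       (fun b => nth 0 (flatten (rev cs)) b.2.-1).

Lemma staircase_rows_le ds k : k \in staircase_rows ds -> 0 < k <= size ds.
Proof.
elim: ds => //= d ds IHds; rewrite mem_cat => /orP[/nseqP[->]|/IHds] //=; lia.
Qed.

Lemma staircase_rows_partition ds : is_partition (staircase_rows ds).
Proof.
have geq_trans : transitive geq by move=> a b c /= ? ?; lia.
rewrite /is_partition (sorted_pairwise geq_trans).
elim: ds => //= d ds IHds; rewrite pairwise_cat IHds andbT; apply/andP; split.
  by apply/allrelP => a b /nseqP[-> _] /staircase_rows_le /=; lia.
by elim: (size d) => //= m ->; rewrite andbT; apply/allP => a /nseqP[-> _] /=.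
Qed.

Lemma zeta_staircase_rows ds j : 0 < j ->
  zeta (staircase_rows ds) j = size (flatten (take ((size ds).+1 - j) ds)).
Proof.
move=> j_gt0; elim: ds => [|d ds IHds]; first by case: (_ - _).
rewrite /zeta /= count_cat count_nseq -/(zeta _ _) IHds /=.
case: (leqP j (size ds).+1) => [le_j|lt_j].
  by rewrite (subSn le_j) /= size_cat mul1n.
have -> : (size ds).+1 - j = 0 by lia.
by have -> : (size ds).+2 - j = 0; [lia | rewrite take0].
Qed.

Lemma zeta_predn s j : 0 < j -> zeta (map predn s) j = zeta s j.+1.
Proof. by move=> j_gt0; rewrite /zeta count_map; apply: eq_count => k /=; lia. Qed.

Lemma column_staircase cs j : j < size cs -> column (staircase cs) j.+1 = nth [::] cs j.
Proof.
move=> lt_j; rewrite /column /= zeta_predn // !zeta_staircase_rows // size_rev.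
set ds := rev cs; have size_ds : size ds = size cs by rewrite size_rev.
have -> : nth [::] cs j = nth [::] ds (size cs - j.+1).
  by rewrite nth_rev ?size_ds; [congr nth; lia | lia].
rewrite !subSS; set k := size cs - j.+1.
have -> : size cs - j = k.+1 by rewrite /k; lia.
have lt_k : k < size ds by rewrite size_ds /k; lia.
rewrite (take_nth [::] lt_k) flatten_rcons size_cat addKn.
have eq_fl : flatten ds = flatten (take k ds) ++ nth [::] ds k ++ flatten (drop k.+1 ds).
  by rewrite -[in LHS](cat_take_drop k ds) flatten_cat (drop_nth [::] lt_k).
rewrite eq_fl; move: (flatten (take k ds)) (nth [::] ds k) (flatten _) => p c q.
apply: (@eq_from_nth _ 0); first by rewrite size_map size_iota.
move=> i; rewrite size_map size_iota => lt_i.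
rewrite (nth_map 0) ?size_iota // nth_iota //= nth_cat.
by rewrite ltnNge leq_addr /= addKn nth_cat lt_i.
Qed.

Lemma column_staircase_out cs j : size cs <= j -> column (staircase cs) j.+1 = [::].
Proof.
move=> le_j; apply: size0nil; rewrite size_column /= zeta_predn //.
rewrite !zeta_staircase_rows // size_rev.
by have -> : (size cs).+1 - j.+1 = 0; [lia | rewrite take0].
Qed.

Lemma staircase_skew n cs : all (fun c => sorted ltn c && all (fun a => 1 <= a <= n) c) cs ->
  skew_tableau n (staircase cs).
Proof.
move=> /allP cs_ok; have out_part := staircase_rows_partition (rev cs).
have inn_part : is_partition (map predn (staircase_rows (rev cs))).
  by apply: homo_sorted out_part => a b /=; lia.
have unique_cell j i : (j, i) \in skew_diagram (staircase cs) ->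
    [/\ 0 < j, 0 < i & part (staircase_rows (rev cs)) i = j].
  rewrite !inE /= /part => /andP[/and3P[j_gt0 i_gt0 le_j]].
  rewrite j_gt0 i_gt0 /= -ltnNge; case: (ltnP i.-1 (size (staircase_rows (rev cs)))) => lt_i.
    by rewrite (nth_map 0) // => lt_j; split=> //; lia.
  by move: le_j; rewrite nth_default //; lia.
have col_nth j i : (j.+1, i) \in skew_diagram (staircase cs) ->
    let c := column (staircase cs) j.+1 in
    let k := i - (zeta (inner (staircase cs)) j.+1).+1 in
    [/\ k < size c, zeta (inner (staircase cs)) j.+1 < i,
        entry (staircase cs) (j.+1, i) = nth 0 c k & j < size cs].
  move=> ji; have := ji; rewrite mem_skew // /cell mem_rows /= => lt_i.
  have lt_k : i - (zeta (inner (staircase cs)) j.+1).+1 < size (column (staircase cs) j.+1).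
    by rewrite size_column /=; lia.
  split=> //; first by case/andP: lt_i.
    rewrite (nth_map 0) ?size_iota; last by move: lt_k; rewrite size_column.
    rewrite nth_iota; last by move: lt_k; rewrite size_column.
    by congr nth; move: lt_i => /=; lia.
  rewrite ltnNge; apply/negP => /column_staircase_out eq0; rewrite eq0 in lt_k; by [].
split=> //.
  case=> j i; rewrite !inE /part /= => /and3P[-> -> /=].
  case: (ltnP i.-1 (size (staircase_rows (rev cs)))) => lt_i; last first.
    by rewrite !nth_default ?size_map.
  by rewrite (nth_map 0) //; lia.
split=> -[[|j] i] ji; try by have [] := unique_cell _ _ ji.
- have [lt_k _ -> lt_j] := col_nth _ _ ji.
  have /cs_ok/andP[_ /allP c_bnd] : nth [::] cs j \in cs by apply: mem_nth.
  by apply: c_bnd; rewrite -column_staircase // mem_nth.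
rewrite /below /= => ji1; have [lt_k lt_i T_i lt_j] := col_nth _ _ ji.
have [lt_k' _ T_i1 _] := col_nth _ _ ji1; move: T_i T_i1 => /= -> ->.
have /cs_ok/andP[c_sorted _] : nth [::] cs j \in cs by apply: mem_nth.
rewrite column_staircase // in lt_k lt_k' *.
by apply: (sorted_ltn_nth ltn_trans 0 c_sorted) => //; move: lt_i => /= lt_i; lia.
Qed.

(** A raise only moves a letter to another column. *)
Lemma steps_letters x y j v : steps x y -> x j v -> exists j', y j' v.
Proof.
move=> xy; elim: xy j => [{}x j xj|i b {}x {}y rb _ IH j xj]; first by exists j.
have [xi xi1] := raisable_letter rb.
have [eq_v|ne_v] := eqVneq v b.
  by apply: (IH i); rewrite /shift_left eqxx eq_v eqxx orbT.
by apply: (IH j); rewrite /shift_left xj ne_v /= !if_same.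
Qed.

Definition realization (M N : nat) (x : arrangement) : skew :=
  staircase [seq [seq v <- iota 0 N | x j v] | j <- iota 0 M].

Lemma realization_column M N x j : j < M ->
  column (realization M N x) j.+1 = [seq v <- iota 0 N | x j v].
Proof.
move=> lt_j; rewrite column_staircase ?size_map ?size_iota //.
by rewrite (nth_map 0) ?size_iota // nth_iota.
Qed.

Lemma realization_contents M N x : finite_support M N x ->
  contents (realization M N x) = x.
Proof.
move=> supp; apply: functional_extensionality => j.
apply: functional_extensionality => v; rewrite mem_contents.
case: (ltnP j M) => [lt_j|le_j].
  rewrite realization_column // mem_filter mem_iota andbC.
  by case: (boolP (x j v)) => [/supp[_ ->]|]; rewrite ?andbF.
rewrite column_staircase_out ?size_map ?size_iota //.
by case: (boolP (x j v)) => [/supp[]|] //; lia.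
Qed.

Lemma realization_skew M n (x : arrangement) : (forall j v, x j v -> 1 <= v <= n) ->
  skew_tableau n (realization M n.+1 x).
Proof.
move=> x_bnd; apply: staircase_skew; apply/allP => c /mapP[j _ ->].
apply/andP; split.
  by apply: sorted_filter; [exact: ltn_trans | exact: iota_ltn_sorted].
by apply/allP => v; rewrite mem_filter => /andP[/x_bnd].
Qed.

Lemma part_staircase_rows ds : part (staircase_rows ds) 1 <= size ds.
Proof.
rewrite /part nth0; case E: (staircase_rows ds) => [|a s] //=.
by have := @staircase_rows_le ds a; rewrite E inE eqxx => /(_ isT)/andP[].
Qed.

(** The columns of T with column j carried to the right end, placed in a
    disconnected skew diagram. *)
Lemma right_key_witness_exists n lam T j : is_partition lam ->
  semistandard n (diagram lam) T -> 1 <= j <= part lam 1 ->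
  exists S, right_key_witness n lam T j S.
Proof.
move=> lam_part T_sst /andP[j_gt0 le_j].
have skT := straight_skew lam_part T_sst.
pose t := contents (straight lam T); pose M := part lam 1.
have supp : finite_support M n.+1 t by apply: finite_support_contents skT _.
have ht : highest t := highest_tableau lam_part T_sst.
have lt_M : M.-1 < M by rewrite /M; lia.
have le_jM : j.-1 <= M.-1 by rewrite /M; lia.
have [x [suppx xt eq_r perm_x _]] := carry_to_last supp ht le_jM lt_M.
have x_bnd i v : x i v -> 1 <= v <= n.
  by move=> /(steps_letters xt)[j']; rewrite /t mem_contents => /(column_mem_bound skT).
pose S := realization M n.+1 x.
have sk : skew_tableau n S by apply: realization_skew.
have eq_x : contents S = x by apply: realization_contents.
have st : steps (contents S) t by rewrite eq_x.
have part_S : part (outer S) 1 <= M.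
  by apply: leq_trans (part_staircase_rows _) _; rewrite size_rev size_map size_iota.
have [out_part _ _ _] := sk.
exists S; split=> //.
- have [S' rect] := rectification_total sk; exists S' => //.
  rewrite /column_lengths (rectification_contents lam_part T_sst sk st rect).
  rewrite (columnsE out_part part_S) (@columnsE (straight lam T) M lam_part (leqnn _)).
  have lengths S1 :
      [seq size c | c <- [seq c <- [seq column S1 j | j <- iota 1 M] | 0 < size c]]
      = [seq k <- [seq size (column S1 j.+1) | j <- iota 0 M] | 0 < k].
    by rewrite -[iota 1 M]/(iota (1 + 0) M) iotaDl -map_comp !filter_map -map_comp.
  rewrite !lengths; apply: perm_filter.
  have to_cnt S1 : skew_tableau n S1 -> [seq size (column S1 j.+1) | j <- iota 0 M]
      = [seq cnt (contents S1) j n.+1 | j <- iota 0 M].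
    by move=> sk1; apply: eq_map => i; rewrite size_column_cnt.
  by rewrite !to_cnt // eq_x.
- exact/(rectifies_toP lam_part T_sst sk).
rewrite /rightmost_column (columnsE out_part part_S).
have -> : iota 1 M = iota 1 M.-1 ++ [:: M.-1.+1].
  have -> : M = M.-1 + 1 by lia.
  by rewrite iotaD addn1.
have size_r : size (column S M.-1.+1) = zeta lam j.
  rewrite -(size_column_cnt _ sk) eq_x eq_r -(prednK j_gt0) size_column_cnt //.
  by rewrite size_column /= subn0.
have gt0 : 0 < zeta lam j by rewrite zeta_part.
by rewrite map_cat filter_cat last_cat /= size_r gt0 /=.
Qed.

(** * Greedy matchings *)

(** The entries us come largest first, and f 1 < ... < f z is a column of which
    only the bottom entry can be matched at any time. *)
Fixpoint greedy (f : nat -> nat) (z : nat) (us : seq nat) : seq nat :=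
  if us is u :: us' then
    if (0 < z) && (u <= f z) then f z :: greedy f z.-1 us' else u :: greedy f z us'
  else [::].

Definition count_lt (s : seq nat) (v : nat) : nat := count (fun a => a < v) s.

Lemma count_lt_rcons_iota (f : nat -> nat) z v :
  count_lt (map f (iota 1 z.+1)) v = count_lt (map f (iota 1 z)) v + (f z.+1 < v).
Proof.
by rewrite -[z.+1 in LHS]addn1 iotaD map_cat /count_lt count_cat /= add1n addn0.
Qed.

Lemma count_lt_big s v : all (fun a => a < v) s -> count_lt s v = size s.
Proof. by rewrite all_count => /eqP. Qed.

Lemma count_lt_le s v w : v <= w -> count_lt s v <= count_lt s w.
Proof. by move=> le_vw; apply: sub_count => a /= lt_av; apply: leq_trans le_vw. Qed.

(** By induction on us.  Suppose that the minimum in [swapped] is attained at w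
    for the smaller elements.  When the largest element u is taken into account,
    w still serves, except if w lies between u and the entry matched with u, or
    if u is unmatched and lies between v and w.  Then the minimum is also
    attained beyond that entry, or at u, respectively. *)
Lemma greedy_swapped f z us :
  {in [pred k | 0 < k <= z] &, {homo f : k k' / k < k'}} ->
  sorted gtn us ->
  (forall v, count_lt (map f (iota 1 z)) v <= count_lt us v) ->
  swapped (count_lt us) (count_lt (map f (iota 1 z))) (count_lt (greedy f z us)).
Proof.
have gtn_trans : transitive gtn by move=> a b c /= ? ?; lia.
elim: us z => [|u us IHus] z f_incr us_sorted dom /=.
  move=> v; have := dom v; split=> [w _|]; [have := dom w|exists v => //];
  by rewrite /count_lt /=; lia.
have us_lt : all (fun a => a < u) us by apply: order_path_min us_sorted.
have us_sorted' : sorted gtn us := path_sorted us_sorted.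
have us_cap w : u <= w -> count_lt us w = size us.
  move=> le_uw; apply: count_lt_big.
  by apply: sub_all us_lt => a /= lt_a; apply: leq_trans le_uw.
have cons_lt s a v : count_lt (a :: s) v = (a < v) + count_lt s v by [].
have z_le w : count_lt (map f (iota 1 z)) w <= z.
  by apply: leq_trans (count_size _ _) _; rewrite size_map size_iota.
case: ifP => [/andP[z_gt0 le_u]|not_match].
  case: z z_gt0 f_incr dom le_u z_le => // z _ f_incr dom le_u z_le.
  rewrite -[z.+1.-1]/z.
  have z_le' w : count_lt (map f (iota 1 z)) w <= z.
    by apply: leq_trans (count_size _ _) _; rewrite size_map size_iota.
  have le_z : z <= size us.
    have := dom (maxn u (f z.+1)).+1.
    rewrite cons_lt us_cap; last by lia.
    rewrite count_lt_big; first by rewrite size_map size_iota; lia.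
    apply/allP => a /mapP[k]; rewrite mem_iota => /andP[k_gt0 lt_k] ->.
    case: (ltngtP k z.+1) => [lt_kz||->]; [|lia|lia].
    by have := f_incr k z.+1; rewrite !inE /= => /(_ ltac:(lia) ltac:(lia) lt_kz); lia.
  have sw : swapped (count_lt us) (count_lt (map f (iota 1 z))) (count_lt (greedy f z us)).
    apply: IHus => // [k k' kz k'z|v].
      by apply: f_incr; move: kz k'z; rewrite !inE; lia.
    have := dom v; rewrite count_lt_rcons_iota cons_lt; have := z_le' v.
    by case: (leqP v u) => [|lt_uv]; [lia | rewrite us_cap; lia].
  move=> v; have [le_w [w le_vw eq_w]] := sw v.
  split=> [w' le_vw'|].
    by rewrite !count_lt_rcons_iota !cons_lt; have := le_w w' le_vw'; lia.
  have [[lt_uw le_wf]|same] : (u < w /\ w <= f z.+1) \/ (u < w) = (f z.+1 < w) by lia.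
    exists (f z.+1).+1; first by lia.
    rewrite !count_lt_rcons_iota !cons_lt.
    have := le_w (f z.+1).+1 ltac:(lia).
    have := @count_lt_le (map f (iota 1 z)) w (f z.+1).+1 ltac:(lia).
    by move: eq_w; rewrite !us_cap; lia.
  by exists w => //; rewrite !count_lt_rcons_iota !cons_lt; lia.
have full : count_lt (map f (iota 1 z)) u = z.
  rewrite count_lt_big ?size_map ?size_iota //.
  apply/allP => a /mapP[k]; rewrite mem_iota => /andP[k_gt0 lt_k] ->.
  have [->|ne_k] := eqVneq k z; first by lia.
  by have := f_incr k z; rewrite !inE /= => /(_ ltac:(lia) ltac:(lia) ltac:(lia)); lia.
have dom' v : count_lt (map f (iota 1 z)) v <= count_lt us v.
  have := dom v; rewrite cons_lt; case: (leqP v u) => [|lt_uv]; first by lia.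
  have := dom u; rewrite cons_lt full ltnn !us_cap //; last by lia.
  by have := z_le v; lia.
move=> v; have [le_w [w le_vw eq_w]] := IHus z f_incr us_sorted' dom' v.
split=> [w' le_vw'|].
  by rewrite !cons_lt; have := le_w w' le_vw'; lia.
have [[le_vu lt_uw]|same] : (v <= u /\ u < w) \/ (u < v) = (u < w) by lia.
  exists u => //; rewrite !cons_lt.
  have := le_w u le_vu; have := z_le w; move: eq_w; rewrite full !us_cap //; last by lia.
  by lia.
by exists w => //; rewrite !cons_lt; lia.
Qed.

Lemma greedy_lt f z us m :
  {in [pred k | 0 < k <= z] &, {homo f : k k' / k < k'}} ->
  (0 < z -> f z < m) -> all (fun a => a < m) us -> all (fun a => a < m) (greedy f z us).
Proof.
elim: us z => //= u us IHus z f_incr lt_f /andP[lt_u lt_us].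
case: ifP => [/andP[z_gt0 le_u]|_] /=; last by rewrite lt_u IHus.
rewrite lt_f //=; apply: IHus => // [k k' kz k'z|z1_gt0].
  by apply: f_incr; move: kz k'z; rewrite !inE; lia.
apply: ltn_trans (lt_f z_gt0).
by have := f_incr z.-1 z; rewrite !inE => /(_ ltac:(lia) ltac:(lia) ltac:(lia)); lia.
Qed.

Lemma greedy_sorted f z us :
  {in [pred k | 0 < k <= z] &, {homo f : k k' / k < k'}} ->
  sorted gtn us -> sorted gtn (greedy f z us).
Proof.
have gtn_trans : transitive gtn by move=> a b c /= ? ?; lia.
elim: us z => //= u us IHus z f_incr us_sorted.
have us_lt : all (fun a => a < u) us by apply: order_path_min us_sorted.
have f_incr' : {in [pred k | 0 < k <= z.-1] &, {homo f : k k' / k < k'}}.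
  by move=> k k' kz k'z; apply: f_incr; move: kz k'z; rewrite !inE; lia.
case: ifP => [/andP[z_gt0 le_u]|not_match] /=;
  rewrite (path_sortedE gtn_trans) IHus ?(path_sorted us_sorted) // andbT.
  apply: greedy_lt => //.
    by move=> z1_gt0; apply: f_incr; rewrite ?inE; lia.
  by apply: sub_all us_lt => a lt_a; apply: leq_trans le_u.
by apply: greedy_lt => // z_gt0; move: not_match; rewrite z_gt0 /=; lia.
Qed.

Lemma scan_cat T z v hs hs' :
  scan T z v (hs ++ hs') = scan T z v hs ++ scan T z (last v (map T (scan T z v hs))) hs'.
Proof. by elim: hs v => //= h hs IHhs v; case: ifP => _ /=; rewrite IHhs. Qed.

Lemma mem_scan T z v hs b : b \in scan T z v hs -> b.1 \in hs /\ b.2 = z b.1.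
Proof.
elim: hs v => //= h hs IHhs v; case: ifP => _; last first.
  by move=> /IHhs[b1 ->]; rewrite inE b1 orbT.
by rewrite inE => /orP[/eqP->|/IHhs[b1 ->]]; rewrite inE ?eqxx // b1 orbT.
Qed.

(** * Scanning paths *)

Section Tableau.

Variables (n : nat) (lam : seq nat) (T : filling).
Hypotheses (lam_part : is_partition lam) (T_sst : semistandard n (diagram lam) T).

Lemma zeta_out l : part lam 1 < l -> zeta lam l = 0.
Proof. by move=> lt_l; have := @zeta_part lam l lam_part; lia. Qed.

Lemma tableau_row l k : 0 < l -> 0 < k -> k <= zeta lam l.+1 -> T (l, k) <= T (l.+1, k).
Proof.
move=> l_gt0 k_gt0 le_k; have [_ row _] := T_sst.
apply: (row (l, k)); rewrite /right_of mem_diagram //=;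
by have := zeta_anti lam (leqnSn l); lia.
Qed.

Lemma tableau_col l : 0 < l ->
  {in [pred k | 0 < k <= zeta lam l] &, {homo (fun k => T (l, k)) : k k' / k < k'}}.
Proof.
move=> l_gt0 k k'; rewrite !inE => kz k'z lt_k.
have [col _] := punctured_skew (straight_skew lam_part T_sst).
by apply: col => //; rewrite /cell ?mem_rows ?xpair_eqE /=; lia.
Qed.

End Tableau.

Section Scan.

Variables (n : nat) (lam : seq nat) (T : filling).
Hypotheses (lam_part : is_partition lam) (T_sst : semistandard n (diagram lam) T).
Variable j : nat.
Hypothesis j_gt0 : 0 < j.

Local Notation path z := (bottom_path lam T j z).

(** The last box left of column l on the path that starts at the bottom of
    column j, when z gives the column lengths. *)
Definition tip (z : nat -> nat) (l : nat) : box :=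
  last (j, z j) [seq b <- path z | b.1 < l].

(** The path has a box in column l. *)
Definition taken (z : nat -> nat) (l : nat) : bool :=
  (l == j) || ((0 < z l) && (T (tip z l) <= T (l, z l))).

Lemma path_split z l : j < l -> l <= (part lam 1).+1 ->
  path z = (j, z j) :: scan T z (T (j, z j)) (iota j.+1 (l - j.+1))
    ++ scan T z (T (tip z l)) (iota l ((part lam 1).+1 - l)) /\
  [seq b <- path z | b.1 < l] = (j, z j) :: scan T z (T (j, z j)) (iota j.+1 (l - j.+1)).
Proof.
move=> lt_jl le_l.
have eq_iota : iota j.+1 (part lam 1 - j)
    = iota j.+1 (l - j.+1) ++ iota l ((part lam 1).+1 - l).
  by rewrite -{2}(subnKC lt_jl) -iotaD; congr iota; lia.
have eq_filter : [seq b <- path z | b.1 < l]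
    = (j, z j) :: scan T z (T (j, z j)) (iota j.+1 (l - j.+1)).
  rewrite /bottom_path eq_iota scan_cat /= lt_jl filter_cat.
  have /all_filterP-> : all (fun b => b.1 < l) (scan T z (T (j, z j)) (iota j.+1 (l - j.+1))).
    by apply/allP => b /mem_scan[]; rewrite mem_iota subnKC // => /andP[].
  rewrite (eq_in_filter (a2 := pred0)) ?filter_pred0 ?cats0 // => b /mem_scan[].
  by rewrite mem_iota => /andP[le_b _] _ /=; rewrite ltnNge le_b.
split=> //; rewrite /tip eq_filter /bottom_path eq_iota scan_cat /=.
by rewrite (last_map T).
Qed.

Lemma tip_start z : tip z j.+1 = (j, z j).
Proof.
rewrite /tip /= ltnSn /= -[RHS]/(last (j, z j) [::]); congr last.
rewrite (eq_in_filter (a2 := pred0)) ?filter_pred0 // => b /mem_scan[].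
by rewrite mem_iota => /andP[lt_jb _] _ /=; rewrite ltnS leqNgt lt_jb.
Qed.

Lemma tip_step z l : j < l -> (part lam 1 < l -> z l = 0) ->
  tip z l.+1 = if taken z l then (l, z l) else tip z l.
Proof.
move=> lt_jl z_out; case: (leqP l (part lam 1)) => [le_l|lt_l]; last first.
  rewrite /taken z_out //= orbF gtn_eqF // /tip; congr last; apply: eq_in_filter => b.
  rewrite inE => /orP[/eqP->|/mem_scan[]] /=; first by lia.
  by rewrite mem_iota; lia.
have [_] := @path_split z l.+1 ltac:(lia) ltac:(lia); rewrite {1}/tip => ->.
have [_ eq_l] := @path_split z l lt_jl ltac:(lia).
rewrite subSn // -[(l - j.+1).+1]addn1 iotaD scan_cat subnKC // -cat_cons last_cat.
rewrite (last_map T) /= /taken gtn_eqF //=.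
rewrite -[last (j, z j) (scan _ _ _ _)]/(last (j, z j)
  ((j, z j) :: scan T z (T (j, z j)) (iota j.+1 (l - j.+1)))).
by rewrite -eq_l -/(tip z l); case: ifP.
Qed.

Lemma mem_path z l k : j <= l -> l <= part lam 1 ->
  ((l, k) \in path z) = taken z l && (k == z l).
Proof.
rewrite leq_eqVlt => /orP[/eqP<- _|lt_jl le_l].
  rewrite /taken eqxx /= /bottom_path inE xpair_eqE eqxx /=.
  by case: (k == z j) => //=; apply/negP => /mem_scan[]; rewrite mem_iota /=; lia.
have [-> _] := @path_split z l lt_jl ltac:(lia).
rewrite inE mem_cat xpair_eqE /taken gtn_eqF //= subSn //=.
have -> : (l, k) \in scan T z (T (j, z j)) (iota j.+1 (l - j.+1)) = false.
  by apply/negP => /mem_scan[]; rewrite mem_iota /=; lia.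
have later v : (l, k) \in scan T z v (iota l.+1 (part lam 1 - l)) = false.
  by apply/negP => /mem_scan[]; rewrite mem_iota /=; lia.
by case: ifP => //= _; rewrite ?inE ?xpair_eqE ?eqxx /= later ?orbF.
Qed.

Lemma mem_fst_path z l : j <= l -> l <= part lam 1 ->
  (l \in map fst (path z)) = taken z l.
Proof.
move=> le_jl le_l; apply/mapP/idP => [[[l' k] in_path /= ->]|tk].
  move: in_path => /[dup]; rewrite {1}inE => /orP[/eqP[-> _]|/mem_scan[]] /=.
    by rewrite mem_path //; [case/andP | lia].
  by rewrite mem_iota => ? _; rewrite mem_path; [case/andP | lia | lia].
by exists (l, z l) => //; rewrite mem_path // tk eqxx.
Qed.

(** What remains of the tableau in the columns from j on has the shape of a
    partition. *)
Definition admissible (z : nat -> nat) : Prop :=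
  (forall l, z l <= zeta lam l) /\ (forall l, j <= l -> z l.+1 <= z l).

Lemma admissible_out z l : admissible z -> part lam 1 < l -> z l = 0.
Proof. by case=> le_z _ /(zeta_out lam_part) z0; have := le_z l; lia. Qed.

Lemma remove_path_taken z l : admissible z -> j <= l ->
  remove_path lam T j z l = z l - taken z l.
Proof.
move=> adm le_jl; rewrite /remove_path; case: (leqP l (part lam 1)) => [le_l|lt_l].
  by rewrite mem_fst_path.
by rewrite (admissible_out adm lt_l).
Qed.

(** Of two adjacent columns of equal length, the right one loses its bottom box
    if the left one does, because rows increase weakly. *)
Lemma admissible_remove z : admissible z -> admissible (remove_path lam T j z).
Proof.
move=> adm; have [le_z anti_z] := adm; split=> [l|l le_jl].
  exact: leq_trans (leq_subr _ _) (le_z l).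
rewrite !remove_path_taken //; last by lia.
have := anti_z l le_jl; rewrite leq_eqVlt => /orP[/eqP eq_z|]; last by lia.
rewrite eq_z; case: (posnP (z l)) => [->//|z_gt0].
case: (boolP (taken z l)) => [tk|_]; last by rewrite subn0 leq_subr.
suff -> : taken z l.+1 by [].
have tip_l : tip z l.+1 = (l, z l).
  move: le_jl; rewrite leq_eqVlt => /orP[/eqP<-|lt_jl]; first exact: tip_start.
  by rewrite tip_step ?tk // => /(admissible_out adm).
rewrite /taken tip_l eq_z z_gt0 /= (tableau_row lam_part T_sst) ?orbT //; first by lia.
by rewrite -eq_z.
Qed.

(** The column lengths when s paths have been removed; the next path starts in
    row zeta_j - s. *)
Definition remaining (s : nat) : nat -> nat := iter s (remove_path lam T j) (zeta lam).

Lemma admissible_remaining s : admissible (remaining s).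
Proof.
elim: s => [|s IHs]; last exact: admissible_remove.
by split=> // l _; apply: zeta_anti.
Qed.

Lemma remainingS s l : j <= l -> remaining s.+1 l = remaining s l - taken (remaining s) l.
Proof. exact: remove_path_taken (admissible_remaining s). Qed.

Lemma remaining_start s : remaining s j = zeta lam j - s.
Proof.
elim: s => [|s IHs]; first by rewrite subn0.
by rewrite remainingS // IHs /taken eqxx; lia.
Qed.

Lemma remaining_decr s s' l : j <= l -> s <= s' -> remaining s' l <= remaining s l.
Proof.
move=> le_jl /subnK <-; elim: (s' - s) => // d IHd.
by rewrite addSn remainingS // (leq_trans (leq_subr _ _)).
Qed.

Lemma remaining_anti s l l' : j <= l -> l <= l' -> remaining s l' <= remaining s l.
Proof.
move=> le_jl /subnK <-; elim: (l' - l) => // d IHd.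
by rewrite addSn; apply: leq_trans IHd; apply: (admissible_remaining s).2; lia.
Qed.

Lemma remaining_end l : j <= l -> remaining (zeta lam j) l = 0.
Proof.
move=> le_jl; have := @remaining_anti (zeta lam j) j l (leqnn j) le_jl.
by rewrite remaining_start; lia.
Qed.

(** (l, k) lies on the path that is removed after s others. *)
Definition removed_at (s l k : nat) : Prop :=
  [/\ s < zeta lam j, remaining s l = k & taken (remaining s) l].

(** All columns from j on are empty when column j is, and each loses at most
    one box at a time. *)
Lemma removal_exists l k : j <= l -> 0 < k -> k <= zeta lam l ->
  exists s, removed_at s l k.
Proof.
move=> le_jl k_gt0 le_k.
have ex_s : exists s, remaining s l < k by exists (zeta lam j); rewrite remaining_end.
have [s lt_s min_s] := ex_minnP ex_s; case: s => [|s] in lt_s min_s.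
  by move: lt_s; rewrite /remaining /=; lia.
have le_s : k <= remaining s l.
  by rewrite leqNgt; apply/negP => /min_s; rewrite ltnn.
have lt_sj : s < zeta lam j.
  by rewrite ltnNge; apply/negP => le_js; have := @remaining_decr _ _ l le_jl le_js;
     rewrite remaining_end //; lia.
exists s; move: lt_s; rewrite remainingS //.
by case: (boolP (taken _ _)) => tk; split=> //; lia.
Qed.

Lemma removed_at_later s l k s' : 0 < k -> j <= l -> removed_at s l k -> s < s' ->
  remaining s' l < k.
Proof.
move=> k_gt0 le_jl [_ eq_k tk] lt_s; apply: leq_ltn_trans (remaining_decr le_jl lt_s) _.
by rewrite remainingS // tk eq_k; lia.
Qed.

Lemma path_row_removed s l k : j <= l -> 0 < k -> k <= zeta lam l ->
  removed_at s l k -> path_row lam T j (l, k) = zeta lam j - s.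
Proof.
move=> le_jl k_gt0 le_k rem; have [lt_s eq_k tk] := rem.
have le_l : l <= part lam 1 by rewrite -zeta_part //; lia.
rewrite /path_row (@eq_in_find _ _ (pred1 (zeta lam j - s))); last first.
  move=> i; rewrite mem_iota => lt_i /=; rewrite mem_path // -/(remaining _).
  apply/andP/eqP => [[tk' /eqP eq_k']|->].
    suff : zeta lam j - i = s by lia.
    case: (ltngtP (zeta lam j - i) s) => // lt_is.
      have rem' : removed_at (zeta lam j - i) l k by split=> //; lia.
      by have := removed_at_later k_gt0 le_jl rem' lt_is; rewrite eq_k ltnn.
    by have := removed_at_later k_gt0 le_jl rem lt_is; rewrite -eq_k' ltnn.
  by rewrite subKn ?(ltnW lt_s) // -/(remaining s) eq_k.
rewrite -/(index _ _).
rewrite -[X in index X _](_ : nth 0 (iota 1 (zeta lam j)) (zeta lam j - s).-1 = _).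
  by rewrite index_uniq ?iota_uniq ?size_iota //; lia.
by rewrite nth_iota; lia.
Qed.

Lemma removed_tip s l k : j < l -> removed_at s l k ->
  T (tip (remaining s) l) <= T (l, k) /\ tip (remaining s) l.+1 = (l, k).
Proof.
move=> lt_jl [_ <- tk]; split.
  by move: tk; rewrite /taken gtn_eqF //= => /andP[].
by rewrite tip_step ?tk // => /(admissible_out (admissible_remaining s)).
Qed.

Lemma tip_incr z l l' : admissible z -> j < l -> l <= l' -> T (tip z l) <= T (tip z l').
Proof.
move=> adm lt_jl /subnK <-; elim: (l' - l) => // d IHd; rewrite addSn.
apply: leq_trans IHd _; rewrite tip_step; try lia; last by move=> /(admissible_out adm).
by case: ifP => //; rewrite /taken gtn_eqF; [case/andP | lia].
Qed.

End Scan.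

(** * The right key *)

Lemma count_lt_inj s s' : sorted ltn s -> sorted ltn s' ->
  count_lt s =1 count_lt s' -> s = s'.
Proof.
move=> s_sorted s'_sorted eq_s.
have memE u v : (v \in u) = (count_lt u v < count_lt u v.+1).
  have -> : count_lt u v.+1 = count_lt u v + count_mem v u.
    by rewrite /count_lt; elim: u => //= a u ->; rewrite ltnS; lia.
  by rewrite -[X in X < _]addn0 ltn_add2l -has_count has_pred1.
by apply: (irr_sorted_eq ltn_trans ltnn s_sorted s'_sorted) => v; rewrite !memE !eq_s.
Qed.

Lemma straight_column lam T l :
  column (straight lam T) l = [seq T (l, k) | k <- iota 1 (zeta lam l)].
Proof. by rewrite /column /= subn0. Qed.

Section RightKey.

Variables (n : nat) (lam : seq nat) (T : filling).
Hypotheses (lam_part : is_partition lam) (T_sst : semistandard n (diagram lam) T).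
Variable j : nat.
Hypothesis j_gt0 : 0 < j.

Local Notation remaining := (remaining lam T j).
Local Notation tip := (tip lam T j).
Local Notation t := (contents (straight lam T)).

Lemma cnt_straight l v :
  cnt t l v = count_lt (column (straight lam T) l.+1) v.
Proof. exact: cnt_contents (straight_skew lam_part T_sst). Qed.

(** The entries reached by the paths before column l, in decreasing order since
    the path from the bottom of column j is found first. *)
Definition tips (l : nat) : seq nat :=
  [seq T (tip (remaining s) l) | s <- iota 0 (zeta lam j)].

Lemma tips_start : tips j.+1 = rev (column (straight lam T) j).
Proof.
apply: (@eq_from_nth _ 0); first by rewrite size_rev size_column /= subn0 size_map size_iota.
move=> s; rewrite size_map size_iota => lt_s.
rewrite straight_column nth_rev ?size_map ?size_iota //.
rewrite !(nth_map 0) ?size_iota //; last by lia.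
rewrite !nth_iota //; last by lia.
rewrite add0n tip_start (remaining_start lam_part T_sst j_gt0); do 2! congr (_ _); lia.
Qed.

Lemma tips_greedy l : j < l ->
  tips l.+1 = greedy (fun k => T (l, k)) (zeta lam l) (tips l).
Proof.
move=> lt_jl; rewrite /tips -[zeta lam l]/(remaining 0 l).
elim: (zeta lam j) 0 => //= m IHm s.
have adm := admissible_remaining lam_part T_sst j_gt0 s.
rewrite tip_step //; last by move=> /(admissible_out lam_part j_gt0 adm).
rewrite IHm (remainingS lam_part T_sst j_gt0 _ (ltnW lt_jl)).
have -> : taken lam T j (remaining s) l
    = (0 < remaining s l) && (T (tip (remaining s) l) <= T (l, remaining s l)).
  by rewrite /taken gtn_eqF.
by case: ifP => _; rewrite ?subn1 ?subn0.
Qed.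

(** The tips lie above column l - 1 as the left column of a tableau would, hence
    also above column l, so that the next exchange makes sense. *)
Lemma tips_dominate l : j < l ->
  sorted gtn (tips l) /\
  forall v, count_lt (column (straight lam T) l.-1) v <= count_lt (tips l) v.
Proof.
have ht := highest_tableau lam_part T_sst.
move=> /subnKC <-; elim: (l - j.+1) => [|d [IHs IHd]].
  rewrite addn0 tips_start; split.
    by rewrite rev_sorted -(prednK j_gt0); apply: column_sorted (straight_skew lam_part T_sst).
  by move=> v; rewrite /count_lt count_rev.
rewrite addnS tips_greedy; last by lia.
have incr := tableau_col lam_part T_sst (ltn_addr d (ltn0Sn j)).
split; first exact: greedy_sorted incr IHs.
have dom v : count_lt [seq T (j.+1 + d, k) | k <- iota 1 (zeta lam (j.+1 + d))] v
    <= count_lt (tips (j.+1 + d)) v.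
  apply: leq_trans (IHd v); rewrite -straight_column addSn /=.
  have -> : j + d = (j.-1 + d).+1 by lia.
  by rewrite -!cnt_straight; apply: ht.
move=> v; rewrite -pred_Sn straight_column.
have [_ [w _ eq_w]] := greedy_swapped incr IHs dom v.
by have := dom w; lia.
Qed.

(** Column h of the arrangement is column h + 1 of T, and the tips before
    column h + 2 include the boxes in it. *)
Lemma carried_tips r : carried t j.-1 r (fun h => count_lt (tips h.+2)).
Proof.
split=> [v|h le_h lt_h].
  by rewrite (prednK j_gt0) tips_start cnt_straight prednK // /count_lt count_rev.
have lt_jh : j < h.+2 by lia.
have [srt dom] := tips_dominate lt_jh; have [_ dom'] := @tips_dominate h.+3 ltac:(lia).
rewrite (tips_greedy lt_jh).
have ht := highest_tableau lam_part T_sst.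
apply: swapped_ext (greedy_swapped (tableau_col lam_part T_sst (ltn0Sn h.+1)) srt _) => //.
  by move=> v; rewrite cnt_straight straight_column.
move=> v; apply: leq_trans (dom v); rewrite -straight_column.
by rewrite -!cnt_straight; apply: ht.
Qed.

Lemma tip_last z l : part lam 1 < l -> j <= part lam 1 ->
  tip z l = last (j, z j) (bottom_path lam T j z).
Proof.
move=> lt_l le_j; rewrite /tip; congr last; apply/all_filterP/allP => b.
rewrite inE => /orP[/eqP->|/mem_scan[]] /=; first by lia.
by rewrite mem_iota addSn subnKC // ltnS => /andP[_ le_b] _; apply: leq_ltn_trans lt_l.
Qed.

Lemma rightmost_tips S : j <= part lam 1 -> right_key_witness n lam T j S ->
  rightmost_column S = rev (tips (part lam 1).+1).
Proof.
move=> le_j [sk fr rect size_r]; have [out_part _ _ _] := sk.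
have skT := straight_skew lam_part T_sst.
have zeta_gt0 : 0 < zeta lam j by rewrite zeta_part.
have [|r [eq_r out_r]] := rightmost_columnP out_part; first by rewrite size_r.
have supp : finite_support r.+1 n.+1 (contents S).
  move=> l v; rewrite mem_contents => v_l; split; last first.
    by have := column_mem_bound sk v_l; lia.
  by rewrite ltnS leqNgt; apply/negP => /out_r eq0; rewrite eq0 in v_l.
have ex := frank_extremal lam_part T_sst sk fr rect supp.
have [_ st ht _] := ex; have supp_t := finite_support_steps st supp.
have col_r l : 0 < l -> l <= part lam 1 -> l.-1 <= r.
  move=> l_gt0 le_l; rewrite -ltnS ltnNge; apply/negP => /(cnt_out n.+1 supp_t).
  rewrite (size_column_cnt _ skT) size_column /= prednK // subn0 => z0.
  by have := zeta_part lam_part l_gt0; rewrite z0 le_l.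
have eq_size : cnt t j.-1 n.+1 = cnt (contents S) r n.+1.
  rewrite (size_column_cnt _ skT) (size_column_cnt _ sk) -eq_r size_r.
  by rewrite size_column /= prednK // subn0.
have car := extremal_last_column ex (col_r j j_gt0 le_j) eq_size (carried_tips r).
have [srt _] := @tips_dominate r.+2 ltac:(have := col_r j j_gt0 le_j; lia).
have eq_tips : tips (part lam 1).+1 = tips r.+2.
  apply: eq_map => s; congr (T _); rewrite !tip_last //.
  by have := col_r (part lam 1) ltac:(lia) (leqnn _); lia.
rewrite eq_tips eq_r; apply: count_lt_inj.
- exact: column_sorted sk.
- by rewrite rev_sorted.
by move=> v; rewrite /count_lt -(cnt_contents r v sk) -car count_rev.
Qed.

Lemma nth_tips i : 0 < i -> i <= zeta lam j -> j <= part lam 1 ->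
  nth 0 (rev (tips (part lam 1).+1)) i.-1 = T (last (j, i) (path_at lam T j i)).
Proof.
move=> i_gt0 le_i le_j; rewrite nth_rev ?size_map ?size_iota; last by lia.
rewrite (nth_map 0) ?size_iota; last by lia.
rewrite nth_iota; last by lia.
by rewrite add0n prednK // tip_last.
Qed.

End RightKey.

(** * The local condition *)

Section Demazure.

Variables (n : nat) (lam : n.-tuple nat) (w : 'S_n) (T : filling).
Hypotheses (lam_part : is_partition lam) (T_sst : semistandard n (diagram lam) T).

Lemma diagram_range j i : (j, i) \in diagram lam ->
  [/\ 0 < j, j <= part lam 1, 0 < i & i <= zeta lam j].
Proof.
rewrite mem_diagram // => /and3P[j_gt0 i_gt0 le_i]; split=> //.
by rewrite -zeta_part //; lia.
Qed.

Lemma demazure_path_ends :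
  demazure lam w T <->
  forall j i, (j, i) \in diagram lam ->
    T (last (j, i) (path_at lam T j i)) <= key_tableau lam w (j, i).
Proof.
split=> [[R keyR leR] j i ji|le_ends].
  have [j_gt0 le_j i_gt0 le_i] := diagram_range ji.
  have [|[S witS] eqR] := keyR j; first by rewrite j_gt0.
  have := eqR S witS; rewrite (rightmost_tips lam_part T_sst j_gt0 le_j witS) => eq_col.
  rewrite -nth_tips // eq_col straight_column (nth_map 0) ?size_iota; last by lia.
  by rewrite nth_iota; [rewrite add1n prednK //; apply: leR | lia].
exists (fun b => T (last b (path_at lam T b.1 b.2))); last by case=> j i; apply: le_ends.
move=> j /andP[j_gt0 le_j]; split.
  by apply: right_key_witness_exists lam_part T_sst _; rewrite j_gt0.
move=> S /(rightmost_tips lam_part T_sst j_gt0 le_j) ->.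
rewrite straight_column; apply: (@eq_from_nth _ 0).
  by rewrite size_rev !size_map !size_iota.
move=> i; rewrite size_rev size_map size_iota => lt_i.
rewrite (nth_map 0) ?size_iota // nth_iota // add1n.
by rewrite -nth_tips.
Qed.

Lemma key_tableau_mono j i i' : 0 < i -> i <= i' -> i' <= zeta lam j ->
  key_tableau lam w (j, i) <= key_tableau lam w (j, i').
Proof.
move=> i_gt0 le_i le_i'; rewrite /key_tableau /=.
set s := sort _ _; have s_sorted : sorted leq s by apply: sort_sorted leq_total _.
have size_s : size s = zeta lam j.
  rewrite size_sort size_take /one_rowed_form size_map size_enum_ord.
  have : zeta lam j <= n by have := count_size (leq j) lam; rewrite size_tuple.
  by case: ltnP => //; lia.
by apply: (sorted_leq_nth leq_trans leqnn 0 s_sorted); rewrite ?inE ?size_s; lia.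
Qed.

Lemma tableau_ge_row l k : (l, k) \in diagram lam -> k <= T (l, k).
Proof.
move=> /diagram_range[l_gt0 _]; elim: k => // k IHk _ le_k.
case: (posnP k) => [k0|k_gt0].
  have [bnd _ _] := T_sst; have := bnd (l, k.+1).
  by rewrite mem_diagram // l_gt0 le_k k0 => /(_ isT)/andP[].
apply: leq_ltn_trans (IHk k_gt0 (ltnW le_k)) _.
by apply: (tableau_col lam_part T_sst l_gt0); rewrite ?inE //; lia.
Qed.

(** While (l, k) is the bottom box of column l, the paths whose entry is larger
    than T (l, k) pass it over and the first other one takes it, so the path
    through (l, k) has the largest i with E(l, k; j, i) <= T (l, k).  The entries
    of the key increase with i. *)
Lemma mem_local_set l k : (l, k) \in diagram lam ->
  (T (l, k) \in local_set lam T l k w) <->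
  (forall j, 0 < j -> j <= l -> T (l, k) <= key_tableau lam w (j, path_row lam T j (l, k))).
Proof.
move=> lk; have [l_gt0 le_l k_gt0 le_k] := diagram_range lk.
have at_j j : 0 < j -> j <= l ->
    has (fun i => path_entry lam T l k j i <= T (l, k) <= key_tableau lam w (j, i))
      (iota (lower_row lam T l k j) (upper_row lam T l k j - lower_row lam T l k j))
    = (T (l, k) <= key_tableau lam w (j, path_row lam T j (l, k))).
  move=> j_gt0 le_jl.
  have [s rem] := removal_exists lam_part T_sst j_gt0 le_jl k_gt0 le_k.
  have eq_row := path_row_removed lam_part T_sst j_gt0 le_jl k_gt0 le_k rem.
  have [lt_s eq_k tk] := rem.
  rewrite /lower_row /upper_row /path_entry; have [eq_jl|ne_jl] := eqVneq j l.
    subst l; rewrite subSnn /= orbF tableau_ge_row //= eq_row.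
    by move: eq_k; rewrite (remaining_start lam_part T_sst j_gt0) => <-.
  have lt_jl : j < l by lia.
  have le_jl1 : j <= l.-1 by lia.
  have le_k1 : k <= zeta lam l.-1 by apply: leq_trans le_k (zeta_anti lam (leq_pred l)).
  have [s1 rem1] := removal_exists lam_part T_sst j_gt0 le_jl1 k_gt0 le_k1.
  have [lt_s1 eq_k1 tk1] := rem1.
  rewrite (path_row_removed lam_part T_sst j_gt0 le_jl1 k_gt0 le_k1 rem1).
  have le_s1 : s <= s1.
    rewrite leqNgt; apply/negP => lt_s1s.
    have := removed_at_later lam_part T_sst j_gt0 k_gt0 le_jl1 rem1 lt_s1s.
    by have := remaining_anti lam_part T_sst j_gt0 s le_jl1 (leq_pred l); lia.
  set b := (X in iota _ (X - _)).
  have b_gt : zeta lam j - s < b <= (zeta lam j).+1 /\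
      forall i, i < b -> i <= zeta lam j -> remaining lam T j (zeta lam j - i) l <= k.
    rewrite /b; case: (ltnP k (zeta lam l)) => [lt_k|le_k'].
      have [s2 rem2] := removal_exists lam_part T_sst j_gt0 le_jl (ltn0Sn k) lt_k.
      have [lt_s2 eq_k2 tk2] := rem2.
      rewrite (path_row_removed lam_part T_sst j_gt0 le_jl (ltn0Sn k) lt_k rem2).
      have lt_s2s : s2 < s.
        rewrite ltnNge; apply/negP => le_s.
        by have := remaining_decr lam_part T_sst j_gt0 le_jl le_s; lia.
      split=> [|i lt_i le_i]; first by lia.
      have lt_s2i : s2 < zeta lam j - i by lia.
      by have := removed_at_later lam_part T_sst j_gt0 (ltn0Sn k) le_jl rem2 lt_s2i; lia.
    split=> [|i _ le_i]; first by lia.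
    by apply: leq_trans ((admissible_remaining lam_part T_sst j_gt0 _).1 l) le_k'.
  have [/andP[lt_b b_le] le_b] := b_gt.
  have entryE i : 0 < i -> i <= zeta lam j ->
      last (j, i) [seq b0 <- path_at lam T j i | b0.1 < l]
      = tip lam T j (remaining lam T j (zeta lam j - i)) l.
    by move=> i_gt0 le_i; rewrite /tip (remaining_start lam_part T_sst j_gt0) subKn.
  rewrite eq_row; apply/hasP/idP => [[i]|le_T].
    rewrite mem_iota => i_range /andP[le_E le_Y].
    have i_gt0 : 0 < i by lia.
    have le_i : i <= zeta lam j by lia.
    suff le_is : i <= zeta lam j - s by apply: leq_trans le_Y (key_tableau_mono _ _ _); lia.
    rewrite leqNgt; apply/negP => lt_is.
    rewrite entryE // in le_E.
    have lt_is' : zeta lam j - i < s by lia.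
    have le_rem : remaining lam T j (zeta lam j - i) l <= k by apply: le_b; lia.
    have := remaining_decr lam_part T_sst j_gt0 le_jl lt_is'.
    rewrite (remainingS lam_part T_sst j_gt0 _ le_jl).
    have eq_rem : remaining lam T j (zeta lam j - i) l = k.
      by have := remaining_decr lam_part T_sst j_gt0 le_jl (ltnW lt_is'); lia.
    rewrite /taken eq_rem gtn_eqF // k_gt0 le_E /= eq_k; lia.
  exists (zeta lam j - s); first by rewrite mem_iota; lia.
  rewrite le_T andbT entryE; try lia.
  rewrite subKn; last by lia.
  by have [] := removed_tip lam_part T_sst j_gt0 lt_jl rem.
rewrite inE; split=> [/allP loc j j_gt0 le_jl|loc].
  by rewrite -at_j //; apply: loc; rewrite mem_iota j_gt0 add1n ltnS.
apply/allP => j; rewrite mem_iota add1n ltnS => /andP[j_gt0 le_jl].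
by rewrite at_j //; apply: loc.
Qed.

End Demazure.

Theorem theorem3p4p1 (n : nat) (lam : n.-tuple nat) (w : 'S_n) (T : filling)
    (n_gt0 : 1 <= n) (lam_part : is_partition lam)
    (T_sst : semistandard n (diagram lam) T) :
  demazure lam w T <->
  (forall l k : nat, (l, k) \in diagram lam ->
     T (l, k) \in local_set lam T l k w).
Proof.
apply: iff_trans (demazure_path_ends w lam_part T_sst) _.
split=> [le_ends l k lk|loc j i ji].
  have [l_gt0 le_l k_gt0 le_k] := diagram_range lam_part lk.
  apply/(mem_local_set w lam_part T_sst lk) => j j_gt0 le_jl.
  have [s rem] := removal_exists lam_part T_sst j_gt0 le_jl k_gt0 le_k.
  have eq_row := path_row_removed lam_part T_sst j_gt0 le_jl k_gt0 le_k rem.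
  have [lt_s eq_k _] := rem.
  rewrite eq_row; set i := zeta lam j - s.
  have ji : (j, i) \in diagram lam by rewrite mem_diagram // j_gt0 /i; lia.
  apply: leq_trans (le_ends j i ji).
  have tip_l : tip lam T j (remaining lam T j s) l.+1 = (l, k).
    move: le_jl; rewrite leq_eqVlt => /orP[/eqP eq_jl|lt_jl].
      by subst l; rewrite tip_start // eq_k.
    by have [] := removed_tip lam_part T_sst j_gt0 lt_jl rem.
  have -> : last (j, i) (path_at lam T j i)
      = tip lam T j (remaining lam T j s) (part lam 1).+1.
    have eq_s : zeta lam j - i = s by rewrite /i subKn // ltnW.
    by rewrite tip_last //; [rewrite /path_at eq_s | lia].
  rewrite -tip_l; apply: tip_incr => //; try lia.
  exact (admissible_remaining lam_part T_sst j_gt0 s).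
have [j_gt0 le_j i_gt0 le_i] := diagram_range lam_part ji.
pose s := zeta lam j - i; pose b := last (j, i) (path_at lam T j i).
have start_i : remaining lam T j s j = i.
  by rewrite (remaining_start lam_part T_sst j_gt0) subKn.
have b_path : b \in bottom_path lam T j (remaining lam T j s).
  exact: (mem_last (j, remaining lam T j s j)).
have : b.1 \in j :: iota j.+1 (part lam 1 - j).
  by move: b_path; rewrite !inE => /orP[/eqP->|/mem_scan[-> _]]; rewrite ?eqxx ?orbT.
rewrite -/b; case: b b_path => l k b_path; rewrite -[_ :: _]/(iota j (part lam 1 - j).+1).
rewrite mem_iota /= => l_range.
have le_jl : j <= l by lia.
have le_l : l <= part lam 1 by lia.
move: b_path; rewrite (mem_path T lam_part j_gt0) // => /andP[tk /eqP eq_k].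
have k_gt0 : 0 < k.
  move: tk; rewrite eq_k /taken => /orP[/eqP->|/andP[]//].
  by rewrite start_i.
have le_k : k <= zeta lam l.
  by rewrite eq_k; apply: (admissible_remaining lam_part T_sst j_gt0 s).1.
have rem : removed_at lam T j s l k by split=> //; rewrite /s; lia.
have lk : (l, k) \in diagram lam by rewrite mem_diagram //; lia.
have := (mem_local_set w lam_part T_sst lk).1 (loc l k lk) j j_gt0 le_jl.
by rewrite (path_row_removed lam_part T_sst j_gt0 le_jl k_gt0 le_k rem) subKn.
Qed.
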